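(* Let $(X_n)_{n\ge 0}$ be a Galton--Watson process with immigration such that $\xi$ is regularly varying with index $\alpha \in [1,\infty)$ and there exists $r \in (\alpha,\infty)$ with $\mathbb{E}(X_0^r) < \infty$ and $\mathbb{E}(\varepsilon^r) < \infty$. Suppose that $\mathbb{P}(X_0 = 0) < 1$ or $\mathbb{P}(\varepsilon = 0) < 1$. In case of $\alpha = 1$, assume additionally that $m_\xi \in (0,\infty)$. Then for each $n \in \mathbb{N}$, we have $$\mathbb{P}(X_n > x) \sim \mathbb{E}(X_0)\, m_\xi^{n-1} \sum_{i=0}^{n-1} m_\xi^{i(\alpha-1)}\, \mathbb{P}(\xi > x) + m_\varepsilon \sum_{i=1}^{n-1} m_\xi^{n-i-1} \sum_{j=0}^{n-i-1} m_\xi^{j(\alpha-1)}\, \mathbb{P}(\xi > x)$$ as $x \to \infty$, and hence $X_n$ is also regularly varying with index $\alpha$.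
   Context: A Galton--Watson process with immigration is a stochastic process $(X_n)_{n\ge 0}$ given by $X_n = \sum_{i=1}^{X_{n-1}} \xi_{n,i} + \varepsilon_n$, $n \ge 1$, where $\{X_0, \xi_{n,i}, \varepsilon_n : n,i \ge 1\}$ are independent non-negative integer-valued random variables, the $\xi_{n,i}$ ($n,i\ge1$) are identically distributed, the $\varepsilon_n$ ($n\ge 1$) are identically distributed, and $\sum_{i=1}^0 := 0$. Here $\xi$ and $\varepsilon$ denote random variables with the distribution of $\xi_{1,1}$ and $\varepsilon_1$, respectively, and $m_\xi := \mathbb{E}(\xi) \in [0,\infty]$, $m_\varepsilon := \mathbb{E}(\varepsilon) \in [0,\infty]$. Empty sums are $0$; $\mathbb{N} = \{1,2,\ldots\}$. A non-negative random variable $X$ is regularly varying with index $\alpha \in [0,\infty)$ if $\mathbb{P}(X > x) > 0$ for all $x > 0$ and $\lim_{x\to\infty} \mathbb{P}(X > qx)/\mathbb{P}(X > x) = q^{-\alpha}$ for all $q > 0$. $f(x) \sim g(x)$ as $x\to\infty$ means $\lim_{x\to\infty} f(x)/g(x) = 1$.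
   Formalization: For n = 1 the formal theorem additionally assumes P(X_0 = 0) < 1: if X_0 = 0 almost surely, then X_1 = ε_1 a.s., the right-hand side is identically 0, and both conclusions fail (e.g. ε = 1). *)

(* Defs.v *)
From HB Require Import structures.
From mathcomp Require Export all_boot all_order all_algebra.
From mathcomp Require Export finmap.
From mathcomp Require Export all_classical all_reals all_analysis.

Set Implicit Arguments.
Unset Strict Implicit.
Unset Printing Implicit Defensive.

Import Order.TTheory GRing.Theory Num.Theory.
Export numFieldNormedType.Exports.

Local Open Scope classical_set_scope.
Local Open Scope ring_scope.

Definition natR (R : realType) (k : nat) : R := k%:R.

Lemma measurable_natR (R : realType) : measurable_fun [set: nat] (@natR R).
Proof. by []. Qed.

HB.instance Definition _ (R : realType) :=
  isMeasurableFun.Build _ _ nat R (@natR R) (@measurable_natR R).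

Section probability_notions.
Context d (T : measurableType d) (R : realType) (P : probability T R).

Definition realRV (X : {RV P >-> nat}) : {RV P >-> R} := (@natR R \o X).

Definition tail (X : {RV P >-> R}) (x : R) : R := fine (ccdf X x).

Definition regularly_varying (X : {RV P >-> R}) (alpha : R) : Prop :=
  [/\ 0 <= alpha,
      forall w, 0 <= X w,
      forall x : R, 0 < x -> 0 < tail X x
    & forall q : R, 0 < q ->
        tail X (q * x) / tail X x @[x --> +oo] --> q `^ (- alpha)].

(* Independence of the family of the [Z i] for [i] in [D]: the product rule
   holds for every finite subfamily. *)
Definition mutually_independent d' (T' : measurableType d') (I : choiceType)
    (D : set I) (Z : I -> {RV P >-> T'}) : Prop :=
  forall J : {fset I}, [set` J] `<=` D ->
  forall A : I -> set T', (forall i, measurable (A i)) ->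
    P (\bigcap_(i in [set` J]) (Z i @^-1` A i)) =
    (\prod_(i <- J) P (Z i @^-1` A i))%E.

Definition identically_distributed d' (T' : measurableType d')
    (X Y : {RV P >-> T'}) : Prop :=
  forall A, measurable A -> distribution P X A = distribution P Y A.

(* The initial value, the offspring numbers and the immigration numbers,
   gathered in a single family. *)
Definition primitives (X0 : {RV P >-> nat}) (xi : nat -> nat -> {RV P >-> nat})
    (eps : nat -> {RV P >-> nat}) (a : unit + nat * nat + nat) :
    {RV P >-> nat} :=
  match a with
  | inl (inl _) => X0
  | inl (inr (n, i)) => xi n i
  | inr n => eps n
  end.

(* [xi] and [eps] are indexed from 1: the values [xi 0 _], [xi _ 0] and [eps 0]
   are irrelevant and excluded from the independence requirement. *)
Definition primitive_indices : set (unit + nat * nat + nat) :=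
  [set a | match a with
           | inl (inl _) => True
           | inl (inr (n, i)) => (1 <= n)%N /\ (1 <= i)%N
           | inr n => (1 <= n)%N
           end].

Record GaltonWatsonImmigration (X : nat -> {RV P >-> nat})
    (xi : nat -> nat -> {RV P >-> nat}) (eps : nat -> {RV P >-> nat}) : Prop := {
  GWI_independent :
    mutually_independent primitive_indices (primitives (X 0%N) xi eps) ;
  GWI_offspring_id : forall n i, (1 <= n)%N -> (1 <= i)%N ->
    identically_distributed (xi n i) (xi 1%N 1%N) ;
  GWI_immigration_id : forall n, (1 <= n)%N ->
    identically_distributed (eps n) (eps 1%N) ;
  GWI_recursion : forall n w, (1 <= n)%N ->
    X n w = (\sum_(1 <= i < (X n.-1 w).+1) xi n i w + eps n w)%N
}.

Definition moment (r : R) (X : {RV P >-> nat}) : \bar R :=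
  ('E_P[(fun w => realRV X w `^ r)%R])%E.

Definition mean (X : {RV P >-> nat}) : \bar R := ('E_P[realRV X])%E.

End probability_notions.

Definition asymp_equiv (R : realType) (f g : R -> R) : Prop :=
  f x / g x @[x --> +oo] --> (1 : R).

(* Main.v *)
Require Import Defs.
From mathcomp Require Import measurable_realfun.
From mathcomp Require Import ring lra zify.
Set Implicit Arguments.
Unset Strict Implicit.
Unset Printing Implicit Defensive.
Import Order.TTheory GRing.Theory Num.Theory.

Local Open Scope classical_set_scope.
Local Open Scope ring_scope.

(** Write [F] for the tail of the offspring law and [m] for its mean. A single
    step of the process is a random sum with [N = X n] terms, to which an
    independent immigration number is added. The heart of the proof is that, if
    the tail of [N] is asymptotic to [c F] with [c >= 0] and [N] has a finite mean,
    then the tail of the random sum is asymptotic to [(E N + c m ^ alpha) F]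
    ([random_sum_tail_cvg]). Indeed the sum exceeds a large [x] in one of two
    ways: one of the [N] offspring numbers is large, which has probability about
    [E N * F x], or [N] itself exceeds [x / m], which has probability about
    [c F (x / m)], that is [c m ^ alpha F x]. As [c = 0] is allowed, the first
    generation, where the tail of [N = X 0] is negligible, is not a special case.

    Two bounds on the tail of a sum of [n] offspring numbers make this rigorous.
    If [n m] stays below a fixed fraction of [x], this tail is at most
    [C n F x] with [C] independent of [n] ([conv_tail_uniform]); this allows the
    sum over the values of [N] to be dominated. If [n m] exceeds [x] by a fixed
    factor, it is close to 1 ([conv_tail_lower]). Since all variables are integer
    valued, the law of a sum of [n] of them is read off the [n]-th power of a
    polynomial, the generating function truncated at some level, and both bounds
    are Chernoff bounds for polynomials with nonnegative coefficients. The first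
    one holds for all indices at once because of the choice of the exponent: for
    the truncation level [y], proportional to [x], it is [L / y] with
    [expR (- L) = n F y], the price of the truncation. All that this bound
    takes from regular variation is the comparison of [F t] with [F (2 t)], iterated
    dyadically ([rv_doubling]).

    The immigration and the initial value are negligible compared with [F] by
    Markov's inequality at an exponent larger than [alpha]
    ([moment_tail_negligible]). The same dyadic comparison shows that [m] is
    finite when [alpha > 1] ([rv_sum_bounded]). Hence the constant [c] of
    generation [n + 1] is [E (X n) + m ^ alpha c], where [c] on the right is that of
    generation [n], and Wald's identity gives the recursion of the means; solving
    both ([gen_constE]) yields the formula. Finally the constant is positive, so the
    tail inherits the regular variation of [F].

    Independence is used through events that are independent of the variables
    not yet consumed ([event_independent]): this property survives the
    intersection with an event on one more variable, which is then consumed, and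
    countable disjoint unions. *)

(** * Limits at infinity and regularly varying tails *)

Section limits_at_infinity.
Context (R : realType).
Implicit Types (f g F : R -> R) (l x t : R).

Lemma near_pinftyP (Q : R -> Prop) : (\forall x \near +oo, Q x) ->
  exists2 M : R, 0 < M & forall x, M <= x -> Q x.
Proof.
move=> [M [_ HM]]; exists (Num.max M 0 + 1) => [|x xM].
  by rewrite ltr_wpDl // le_max lexx orbT.
by apply: HM; apply: lt_le_trans xM; rewrite ltr_pwDr // le_max lexx.
Qed.

Lemma near_pinfty_gtP (Q : R -> Prop) (M : R) : (forall x, M <= x -> Q x) ->
  \forall x \near +oo, Q x.
Proof. by move=> HM; exists M; split; [exact: num_real | move=> x /ltW /HM]. Qed.

Lemma cvg_pinfty_epsP f l :
  (forall e, 0 < e -> \forall x \near +oo, f x <= l + e) ->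
  (forall e, 0 < e -> \forall x \near +oo, l - e <= f x) ->
  f x @[x --> +oo] --> l.
Proof.
move=> fu fl; apply/cvgrPdist_le => e e0.
near=> x; rewrite ler_distlC; apply/andP; split.
  by near: x; exact: fl.
by near: x; exact: fu.
Unshelve. all: by end_near. Qed.

Lemma cvg_pinfty_le f l e : f x @[x --> +oo] --> l -> 0 < e ->
  \forall x \near +oo, f x <= l + e.
Proof.
move=> fl e0; have /cvgr_lt := fl; move=> /(_ (l + e)).
by rewrite ltrDl => /(_ e0); apply: filterS => x /ltW.
Qed.

Lemma cvg_pinfty_ge f l e : f x @[x --> +oo] --> l -> 0 < e ->
  \forall x \near +oo, l - e <= f x.
Proof.
move=> fl e0; have /cvgr_gt := fl; move=> /(_ (l - e)).
by rewrite gtrBl => /(_ e0); apply: filterS => x /ltW.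
Qed.

Lemma cvg_pinfty_scale f l (q : R) : 0 < q -> f x @[x --> +oo] --> l ->
  f (q * x) @[x --> +oo] --> l.
Proof.
move=> q0 fl; apply: cvg_comp fl.
by apply: gt0_cvgMry => //; exact: cvg_id.
Qed.

Lemma powR_continuous_base (a p : R) : 0 < a -> {for a, continuous (fun x : R => x `^ p)}.
Proof.
move=> a0; apply: differentiable_continuous; apply/derivable1_diffP.
by have [] := is_derive1_powR p a0.
Qed.

(** Iterating the contraction along [t, 2 t, 4 t] and so on gives geometric decay;
    the bound on one dyadic block starts the iteration. *)
Lemma dyadic_contraction_cvg0 f (rho t0 B : R) : 0 < t0 -> 0 <= rho < 1 ->
  (forall t, 0 <= f t) -> (forall t, t0 <= t -> f (2 * t) <= rho * f t) ->
  (forall t, t0 <= t <= 2 * t0 -> f t <= B) -> f x @[x --> +oo] --> 0.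
Proof.
move=> t00 /andP[rho0 rho1] f0 frho fB.
have B0 : 0 <= B by apply: le_trans (fB t0 _) => //; apply/andP; split; lra.
have bnd j t : t0 <= t <= 2 ^+ j * t0 -> f t <= B.
  elim: j t => [|j IH] t.
    by rewrite expr0 mul1r => ht; apply: fB; lra.
  rewrite exprS => /andP[t0t tj].
  case: (lerP t (2 * t0)) => ht; first by apply: fB; rewrite t0t.
  have -> : t = 2 * (t / 2) by lra.
  apply: le_trans (frho _ _) _; first lra.
  rewrite -[leRHS]mul1r; apply: ler_pM => //; first exact: ltW.
  apply: IH; apply/andP; split; first lra.
  by rewrite ler_pdivrMr // mulrC mulrA.
have bnd' t : t0 <= t -> f t <= B.
  move=> t0t; have [j Hj] : exists j, t <= 2 ^+ j * t0.
    exists (Num.truncn (t / t0)).+1.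
    rewrite -ler_pdivrMr //; apply: le_trans (ltW (truncnS_gt _)) _.
    by rewrite -natrX ler_nat; apply/ltnW/ltn_expl.
  by apply: (bnd j); rewrite t0t Hj.
have dec k t : 2 ^+ k * t0 <= t -> f t <= rho ^+ k * B.
  elim: k t => [|k IH] t; first by rewrite !expr0 !mul1r => /bnd'.
  rewrite !exprS => ht.
  have -> : t = 2 * (t / 2) by lra.
  have ht2 : 2 ^+ k * t0 <= t / 2 by rewrite ler_pdivlMr // mulrC mulrA.
  apply: le_trans (frho _ _) _.
    apply: le_trans ht2; rewrite -[leLHS]mul1r ler_pM2r //.
    by rewrite exprn_ege1 // ler1n.
  by rewrite -mulrA; apply: ler_wpM2l => //; exact: IH.
apply: cvg_pinfty_epsP => e e0; last first.
  by apply: (@near_pinfty_gtP _ 0) => x _; rewrite sub0r (le_trans _ (f0 x)) // oppr_le0 ltW.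
rewrite add0r.
have : rho ^+ n @[n --> \oo] --> 0 by apply: cvg_expr; rewrite ger0_norm.
move=> /cvgr_lt /(_ (e / (B + 1))).
have eB : 0 < e / (B + 1) by rewrite divr_gt0 // ltr_wpDl.
move=> /(_ eB) [k _ /(_ k (leqnn k))] /= hk.
apply: (@near_pinfty_gtP _ (2 ^+ k * t0)) => x /dec /le_trans; apply.
apply: le_trans (_ : e / (B + 1) * B <= _).
  by apply: ler_wpM2r => //; exact: ltW.
rewrite mulrAC ler_pdivrMr ?ltr_wpDl //.
by rewrite ler_pM2l // lerDl.
Qed.

End limits_at_infinity.

Section regularly_varying_tails.
Context (R : realType) (F : R -> R) (alpha : R).

(** Regular variation of a tail, detached from any random variable: the
    asymptotic arguments concern the function alone. *)
Record rv_tail : Prop := RVTail {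
  rv_gt0 : forall t, 0 < F t ;
  rv_le1 : forall t, F t <= 1 ;
  rv_noninc : forall s t, s <= t -> F t <= F s ;
  rv_cvg0 : F x @[x --> +oo] --> 0 ;
  rv_ratio : forall q : R, 0 < q ->
    F (q * x) / F x @[x --> +oo] --> q `^ (- alpha)
}.

Context (rvF : rv_tail).

(** Halving the argument costs a constant factor: far out by
    regular variation, and near the origin because the tail is bounded away
    from 0 there. The constant is taken of the form [2 ^ d] so that iterating
    produces powers. *)
Lemma rv_doubling : exists d : nat, forall t, 0 <= t -> F t <= 2 ^+ d * F (2 * t).
Proof.
have /cvg_pinfty_ge := rv_ratio rvF (ltr0Sn R 1).
have a0 : 0 < (2 : R) `^ (- alpha) by rewrite powR_gt0.
move=> /(_ (2 `^ (- alpha) / 2)) /(_ _) /near_pinftyP [|t0 t00 ht0].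
  by rewrite divr_gt0.
set D := Num.max (2 / 2 `^ (- alpha)) (F (2 * t0))^-1.
have FD t : 0 <= t -> F t <= D * F (2 * t).
  move=> tp; case: (lerP t0 t) => ht.
    have := ht0 t ht; rewrite ler_pdivlMr ?(rv_gt0 rvF) // => H.
    apply: le_trans (_ : 2 / 2 `^ (- alpha) * F (2 * t) <= _).
      rewrite -ler_pdivrMl ?divr_gt0 // invfM invrK mulrC.
      by apply: le_trans H; rewrite mulrC; lra.
    by rewrite ler_pM2r ?(rv_gt0 rvF) // le_max lexx.
  apply: le_trans (rv_le1 rvF _) _.
  apply: le_trans (_ : (F (2 * t0))^-1 * F (2 * t) <= _).
    rewrite mulrC ler_pdivlMr ?(rv_gt0 rvF) // mul1r.
    by apply: (rv_noninc rvF); lra.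
  by rewrite ler_pM2r ?(rv_gt0 rvF) // le_max lexx orbT.
exists (Num.truncn D).+1 => t tp; apply: le_trans (FD t tp) _.
rewrite ler_pM2r ?(rv_gt0 rvF) //.
apply: le_trans (ltW (truncnS_gt _)) _.
by rewrite -natrX ler_nat; apply/ltnW/ltn_expl.
Qed.

Lemma rv_doubling_iter d : (forall t, 0 <= t -> F t <= 2 ^+ d * F (2 * t)) ->
  forall k y, 0 <= y -> F (y / 2 ^+ k) <= (2 ^+ d) ^+ k * F y.
Proof.
move=> Fd; elim=> [|k IH] y y0; first by rewrite !expr0 divr1 mul1r.
apply: le_trans (Fd _ _) _; first by rewrite divr_ge0 // exprn_ge0.
have -> : 2 * (y / 2 ^+ k.+1) = y / 2 ^+ k.
  by rewrite exprS; field; rewrite expf_eq0; lra.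
rewrite [X in _ <= X * _]exprS -mulrA; apply: ler_wpM2l (IH _ y0).
by rewrite exprn_ge0.
Qed.

(** The ratio of the values of this quotient at [2 x] and at [x] tends to
    [2 `^ (alpha - r)], which is less than 1. *)
Lemma rv_power_negligible (r : R) : 0 <= r -> alpha < r ->
  x `^ (- r) / F x @[x --> +oo] --> 0.
Proof.
move=> rge0 ar.
(* a value strictly between the limit of [F (2 t) / F t] and [2 `^ (- r)] *)
set mu : R := (2 `^ (- alpha) + 2 `^ (- r)) / 2.
have r2 : 0 < (2 : R) `^ (- r) by rewrite powR_gt0.
have lt2 : (2 : R) `^ (- r) < 2 `^ (- alpha).
  rewrite !powRN ltf_pV2 ?posrE ?powR_gt0 //.
  by rewrite /powR !pnatr_eq0 /= ltr_expR ltr_pM2r ?ln_gt0 ?ltr1n.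
have mu0 : 0 < mu by rewrite /mu; lra.
have /cvgr_gt := rv_ratio rvF (ltr0Sn R 1).
move=> /(_ mu) /(_ _) /near_pinftyP [|t0 t00 ht0]; first by rewrite /mu; lra.
apply: (@dyadic_contraction_cvg0 _ _ (2 `^ (- r) / mu) t0 (t0 `^ (- r) / F (2 * t0)))
  => //.
- by rewrite divr_ge0 ?ltW //= ltr_pdivrMr // mul1r /mu; lra.
- by move=> t; rewrite divr_ge0 ?powR_ge0 // ltW // (rv_gt0 rvF).
- move=> t ht; have tp : 0 < t by lra.
  rewrite powRM ?(ltW tp) //.
  have := ht0 t ht; rewrite ltr_pdivlMr ?(rv_gt0 rvF) // => H.
  have -> : 2 `^ (- r) / mu * (t `^ (- r) / F t) =
    2 `^ (- r) * t `^ (- r) / (mu * F t) by rewrite [(mu * F t)^-1]invfM mulrACA.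
  rewrite ler_pM2l ?mulr_gt0 ?powR_gt0 // lef_pV2 ?posrE ?mulr_gt0 ?(rv_gt0 rvF) //.
  exact: ltW.
- move=> t /andP[h1 h2]; apply: ler_pM; rewrite ?powR_ge0 ?invr_ge0 ?(ltW (rv_gt0 rvF _)) //.
    rewrite !powRN lef_pV2 ?posrE ?powR_gt0 ?(lt_le_trans t00) //.
    by rewrite ge0_ler_powR // ?nnegrE ?ltW // (lt_le_trans t00).
  by rewrite lef_pV2 ?posrE ?(rv_gt0 rvF) //; apply: (rv_noninc rvF).
Qed.

(** For [alpha > 1] the integer samples of [F] are summable: grouping them in
    pairs, the partial sums [A] satisfy [A (2 M) <= c + rho A M <= c + rho A (2 M)]
    with [rho < 1]. *)
Lemma rv_sum_bounded : 1 < alpha ->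
  exists B : R, forall M, \sum_(0 <= k < M) F k%:R <= B.
Proof.
move=> a1; have lt2 : (2 : R) `^ (- alpha) < 2^-1.
  rewrite powRN ltf_pV2 ?posrE ?powR_gt0 //.
  rewrite -[ltLHS]powRr1 //.
  by rewrite /powR !pnatr_eq0 /= ltr_expR ltr_pM2r ?ln_gt0 ?ltr1n.
set rho : R := 2 `^ (- alpha) + 2^-1.
have rho1 : rho < 1 by rewrite /rho; lra.
have rho0 : 0 < rho by rewrite /rho ltr_wpDl ?powR_ge0.
have /cvgr_lt := rv_ratio rvF (ltr0Sn R 1).
move=> /(_ (rho / 2)) /(_ _) /near_pinftyP [|t0 t00 ht0]; first by rewrite /rho; lra.
pose A M := \sum_(0 <= k < M) F k%:R.
pose c := (Num.truncn t0).+1.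
have A_mono M N : (M <= N)%N -> A M <= A N.
  move=> MN; rewrite /A (big_cat_nat _ MN) //= lerDl sumr_ge0 // => i _.
  exact/ltW/(rv_gt0 rvF).
have A2 M : A M.*2 = \sum_(0 <= k < M) (F k.*2%:R + F k.*2.+1%:R).
  elim: M => [|M IH]; first by rewrite /A !big_nil.
  by rewrite /A doubleS !big_nat_recr //= -/(A _) IH addrA.
have AM M : A M <= (c%:R * 2) / (1 - rho).
  apply: le_trans (A_mono _ M.*2 _) _; first by rewrite -addnn leq_addr.
  rewrite ler_pdivlMr ?subr_gt0 // mulrBr mulr1 lerBlDr.
  rewrite {1}A2.
  apply: le_trans (_ : \sum_(0 <= k < M) ((if (k < c)%N then 2 else 0) + rho * F k%:R) <= _).
    apply: ler_sum_nat => k _.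
    case: ltnP => kc.
      by have := rv_le1 rvF k.*2%:R; have := rv_le1 rvF k.*2.+1%:R;
        have := mulr_gt0 rho0 (rv_gt0 rvF k%:R); lra.
    have : t0 <= k%:R.
      by apply: le_trans (ltW (truncnS_gt _)) _; rewrite ler_nat.
    move=> /ht0; rewrite ltr_pdivrMr ?(rv_gt0 rvF) // => H.
    have : F k.*2.+1%:R <= F k.*2%:R by apply: (rv_noninc rvF); rewrite ler_nat.
    by rewrite -muln2 natrM mulrC; lra.
  rewrite big_split /= lerD //.
    suff -> : \sum_(0 <= k < M) (if (k < c)%N then 2 else 0) = (minn M c)%:R * 2 :> R.
      by rewrite ler_pM2r // ler_nat geq_minr.
    elim: M => [|M IH]; first by rewrite big_nil min0n mul0r.
    rewrite big_nat_recr //= IH; case: ltnP => Mc.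
      by have -> : minn M.+1 c = M.+1; [lia | rewrite -natr1; ring].
    by have -> : minn M.+1 c = c; [lia | rewrite addr0].
  by rewrite -mulr_sumr mulrC ler_pM2r // A_mono // -addnn leq_addr.
by exists (c%:R * 2 / (1 - rho)).
Qed.

End regularly_varying_tails.

(** * Convolution powers and Chernoff bounds *)

Section truncated_generating_function.
Context (R : realType).
Implicit Types (P Q : {poly R}) (p : nat -> R).

Definition nonneg_coefs P := forall j, 0 <= P`_j.

Lemma nonneg_coefsX Q n : nonneg_coefs Q -> nonneg_coefs (Q ^+ n).
Proof.
move=> Q0; elim: n => [|n IH] j; first by rewrite expr0 coef1; case: eqP.
by rewrite exprS coefM sumr_ge0 // => i _; rewrite mulr_ge0.
Qed.

Lemma coefX_le P Q n : nonneg_coefs P -> (forall j, P`_j <= Q`_j) ->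
  forall j, (P ^+ n)`_j <= (Q ^+ n)`_j.
Proof.
move=> P0 PQ; elim: n => [|n IH] j; first by rewrite !expr0.
rewrite !exprS !coefM; apply: ler_sum => i _; apply: ler_pM => //.
exact: nonneg_coefsX.
Qed.

Lemma horner_coefs_split P (z : R) K :
  P.[z] = \sum_(0 <= j < K) P`_j * z ^+ j +
          \sum_(K <= j < size P + K) P`_j * z ^+ j.
Proof.
rewrite -big_cat_nat //= ?leq_addl //.
by rewrite big_mkord (@horner_coef_wide _ (size P + K)) // leq_addr.
Qed.

(** Above [K], weighting the coefficients by [z ^+ (j - K)] can only increase them;
    symmetrically in [chernoff_lower], with [z <= 1]. *)
Lemma chernoff_upper P (z : R) K : nonneg_coefs P -> 1 <= z ->
  P.[1] - \sum_(0 <= j < K) P`_j <= P.[z] / z ^+ K.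
Proof.
move=> P0 z1; have z0 : 0 < z by apply: lt_le_trans z1.
rewrite !(horner_coefs_split P _ K) [X in X + _ - _](eq_bigr (fun j => P`_j));
  last by move=> j _; rewrite expr1n mulr1.
rewrite addrAC subrr add0r ler_pdivlMr ?exprn_gt0 // mulr_suml.
apply: le_trans (_ : \sum_(K <= j < size P + K) P`_j * z ^+ j <= _).
  apply: ler_sum_nat => j /andP[Kj _].
  by rewrite expr1n mulr1; apply: ler_wpM2l => //; rewrite ler_weXn2l.
by rewrite lerDr sumr_ge0 // => j _; rewrite mulr_ge0 // exprn_ge0 // ltW.
Qed.

Lemma chernoff_lower P (z : R) K : nonneg_coefs P -> 0 < z <= 1 ->
  \sum_(0 <= j < K.+1) P`_j <= P.[z] / z ^+ K.
Proof.
move=> P0 /andP[z0 z1].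
rewrite ler_pdivlMr ?exprn_gt0 // mulr_suml.
rewrite (horner_coefs_split P z K.+1).
apply: le_trans (_ : \sum_(0 <= j < K.+1) P`_j * z ^+ j <= _).
  apply: ler_sum_nat => j /andP[_ Kj].
  by apply: ler_wpM2l => //; rewrite ler_wiXn2l // ltW.
by rewrite lerDl sumr_ge0 // => j _; rewrite mulr_ge0 // exprn_ge0 // ltW.
Qed.

Lemma bernoulli_le (a : R) n : 0 <= a <= 1 -> 1 - n%:R * a <= (1 - a) ^+ n.
Proof.
move=> /andP[a0 a1]; elim: n => [|n IH]; first by rewrite mul0r subr0 expr0.
rewrite exprS -natr1.
have : (1 - a) * (1 - n%:R * a) <= (1 - a) * (1 - a) ^+ n.
  by apply: ler_wpM2l => //; lra.
have : 0 <= n%:R * a * a by rewrite !mulr_ge0.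
by nra.
Qed.

Lemma expR_sub1_le (d v : R) : 0 < d <= 1 -> 0 <= v <= d / 4 ->
  expR v - 1 <= (1 + d / 2) * v.
Proof.
move=> /andP[d0 d1] /andP[v0 vd].
have v1 : 0 < 1 - v by lra.
have : expR v <= (1 - v)^-1.
  rewrite -[expR v]invrK -expRN lef_pV2 ?posrE ?expR_gt0 //.
  exact: expR_ge1Dx.
have : (1 - v)^-1 <= 1 + (1 + d / 2) * v.
  rewrite -[leLHS]mul1r ler_pdivrMr //.
  have h1 : 0 <= v * (d / 4 - v) by rewrite mulr_ge0 //; lra.
  have h2 : 0 <= v * d by rewrite mulr_ge0 //; lra.
  have h3 : 0 <= v * d * (1 - v) by rewrite mulr_ge0 //; lra.
  have h4 : v * d <= v by rewrite ler_piMr.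
  nra.
lra.
Qed.

Lemma expRN_le (th v : R) : 0 < th < 1 -> 0 <= v <= th ->
  expR (- v) <= 1 - (1 - th) * v.
Proof.
move=> /andP[t0 t1] /andP[v0 vt].
have v1 : 0 < 1 + v by lra.
have : expR (- v) <= (1 + v)^-1.
  by rewrite expRN lef_pV2 ?posrE ?expR_gt0 //; exact: expR_ge1Dx.
move=> /le_trans; apply.
rewrite -[leLHS]mul1r ler_pdivrMr //.
have h1 : 0 <= v * (th - v) by rewrite mulr_ge0 //; lra.
have h2 : 0 <= v * v * th by rewrite !mulr_ge0 //; lra.
nra.
Qed.

Definition truncated_gf p M : {poly R} := \poly_(k < M.+1) p k.

(** The tail of the [n]-fold convolution power of the law [p] on [nat]. Truncating
    the generating function at [truncn x] changes no coefficient of its power up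
    to that degree, and makes it a polynomial. *)
Definition conv_tail p n (x : R) : R :=
  1 - \sum_(0 <= j < (Num.truncn x).+1) (truncated_gf p (Num.truncn x) ^+ n)`_j.

End truncated_generating_function.

Section uniform_tail_bounds.
Context (R : realType) (p : nat -> R) (F : R -> R).

Record discrete_tail : Prop := DiscreteTail {
  dt_ge0 : forall k, 0 <= p k ;
  dt_sum : forall M, \sum_(0 <= k < M.+1) p k = 1 - F M%:R ;
  dt_truncn : forall y, 0 <= y -> F y = F (Num.truncn y)%:R
}.

Context (pF : discrete_tail).

Lemma truncated_gf_ge0 M : nonneg_coefs (truncated_gf p M).
Proof. by move=> j; rewrite coef_poly; case: ifP => // _; exact: (dt_ge0 pF). Qed.

Lemma truncated_gf_le M N j : (M <= N)%N ->
  (truncated_gf p M)`_j <= (truncated_gf p N)`_j.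
Proof.
move=> MN; rewrite !coef_poly; case: ltnP => jM; last first.
  by case: ifP => // _; exact: (dt_ge0 pF).
by rewrite (leq_trans jM).
Qed.

Lemma horner_truncated_gf M z :
  (truncated_gf p M).[z] = \sum_(0 <= k < M.+1) p k * z ^+ k.
Proof.
rewrite (@horner_coef_wide _ M.+1) ?size_poly // big_mkord.
by apply: eq_bigr => i _; rewrite coef_poly ltn_ord.
Qed.

Lemma dt_sum_gt M (t : R) : 0 <= t -> (forall y, 0 <= F y) ->
  \sum_(0 <= k < M.+1) p k * (t < k%:R)%R%:R <= F t.
Proof.
move=> t0 F0.
have tk k : (t < k%:R) = (Num.truncn t < k)%N by rewrite truncn_lt_nat.
case: (leqP M (Num.truncn t)) => Mt.
  rewrite big_nat_cond big1 ?F0 // => k /andP[/andP[_ kM] _].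
  by rewrite tk ltnNge (leq_trans _ Mt) // mulr0.
rewrite (@big_cat_nat _ _ _ (Num.truncn t).+1) //=; last by rewrite ltnW // ltnS.
rewrite big_nat_cond big1 ?add0r; last first.
  by move=> k /andP[/andP[_ kM] _]; rewrite tk ltnNge -ltnS kM mulr0.
apply: le_trans (_ : \sum_((Num.truncn t).+1 <= k < M.+1) p k <= _).
  apply: ler_sum_nat => k _; apply: ler_piMr; first exact: (dt_ge0 pF).
  by case: (_ < _).
have := dt_sum pF M; rewrite (@big_cat_nat _ _ _ (Num.truncn t).+1) //=; last first.
  by rewrite ltnW // ltnS.
rewrite (dt_sum pF) -(dt_truncn pF t0) => H.
have := F0 M%:R; lra.
Qed.

(** If no summand exceeds [y], the law may be replaced with its truncation at [y],
    to which Chernoff's bound applies; some summand exceeds [y] with probability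
    at most [n * F y]. *)
Lemma conv_tail_chernoff n (x y s : R) : 0 <= y <= x -> 0 <= s ->
  (forall t, 0 <= F t <= 1) ->
  conv_tail p n x <= n%:R * F y +
    expR (n%:R * (\sum_(0 <= k < (Num.truncn y).+1) p k * (expR (s * k%:R) - 1)) - s * x).
Proof.
move=> /andP[y0 yx] s0 F01; set M := Num.truncn y; set X := Num.truncn x.
have MX : (M <= X)%N by exact: le_truncn.
have x0 : 0 <= x by exact: le_trans yx.
set Q := truncated_gf p M.
have Q1 : Q.[1] = 1 - F y.
  rewrite horner_truncated_gf (dt_truncn pF y0) -(dt_sum pF).
  by apply: eq_bigr => k _; rewrite expr1n mulr1.
have Qz : Q.[expR s] <= expR (\sum_(0 <= k < M.+1) p k * (expR (s * k%:R) - 1)).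
  apply: le_trans (expR_ge1Dx _).
  rewrite horner_truncated_gf.
  rewrite (eq_bigr (fun k => p k * expR (s * k%:R))); last first.
    by move=> k _; rewrite mulrC -expRM_natl mulrC [k%:R * _]mulrC.
  under [in leRHS]eq_bigr => k _ do rewrite mulrBr mulr1.
  rewrite big_split /= sumrN (dt_sum pF).
  have := F01 M%:R; lra.
have z1 : 1 <= expR s by rewrite -expR0 ler_expR.
have := chernoff_upper X.+1 (nonneg_coefsX n (truncated_gf_ge0 M)) z1.
rewrite -/Q !horner_exp Q1.
have := bernoulli_le n (F01 y).
have : conv_tail p n x <= 1 - \sum_(0 <= j < X.+1) (Q ^+ n)`_j.
  rewrite /conv_tail -/X lerD2l lerN2; apply: ler_sum => j _.
  by apply: coefX_le; [exact: truncated_gf_ge0 | move=> i; exact: truncated_gf_le].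
suff : Q.[expR s] ^+ n / expR s ^+ X.+1 <=
  expR (n%:R * (\sum_(0 <= k < M.+1) p k * (expR (s * k%:R) - 1)) - s * x) by lra.
rewrite expRD expRN expRM_natl; apply: ler_pM.
- rewrite exprn_ge0 // horner_truncated_gf sumr_ge0 // => k _.
  by rewrite mulr_ge0 ?(dt_ge0 pF) // exprn_ge0 // expR_ge0.
- by rewrite invr_ge0 exprn_ge0 // expR_ge0.
- rewrite lerXn2r ?nnegrE ?expR_ge0 //.
  rewrite horner_truncated_gf sumr_ge0 // => k _.
  by rewrite mulr_ge0 ?(dt_ge0 pF) // exprn_ge0 // expR_ge0.
- rewrite lef_pV2 ?posrE ?exprn_gt0 ?expR_gt0 // -expRM_natl ler_expR mulrC.
  by apply: ler_wpM2r => //; exact/ltW/truncnS_gt.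
Qed.

End uniform_tail_bounds.
(** * One big jump, uniformly in the number of summands *)

Section big_jump.
Context (R : realType) (p : nat -> R) (F : R -> R) (alpha m : R).
Context (pF : discrete_tail p F) (rvF : rv_tail F alpha).
Context (mean_le : forall M, \sum_(0 <= k < M.+1) p k * k%:R <= m).

Lemma rv_ge0 t : 0 <= F t. Proof. exact/ltW/(rv_gt0 rvF). Qed.

Lemma power_le_expR (d : nat) (L : R) : 0 <= L -> L ^+ d <= d`!%:R * expR L.
Proof.
move=> L0; case: d => [|d].
  by rewrite expr0 fact0 mul1r -expR0 ler_expR.
rewrite mulrC -ler_pdivrMr ?ltr0n ?fact_gt0 //.
by have := expR_ge1Dxn d L0; lra.
Qed.

Lemma exists_dyadic (lam : R) : 1 <= lam ->
  exists k : nat, lam <= 2 ^+ k <= 2 * lam.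
Proof.
move=> l1.
have ex : exists k : nat, lam <= 2 ^+ k.
  exists (Num.truncn lam).+1.
  apply: le_trans (ltW (truncnS_gt _)) _.
  by rewrite -natrX ler_nat; apply/ltnW/ltn_expl.
exists (ex_minn ex); case: ex_minnP => k -> kmin /=.
case: k kmin => [|k] kmin; first by rewrite expr0; lra.
have : ~~ (lam <= 2 ^+ k) by apply/negP => /kmin; rewrite ltnn.
by rewrite -ltNge exprS ler_pM2l // => /ltW.
Qed.

(** Doubling bounds [F] at a point divided by [lam] by a power of [lam], which an
    exponential absorbs. *)
Lemma rv_shrink_expR (c : R) : 0 < c <= 1 -> exists2 C : R, 0 <= C &
  forall L y : R, 1 <= L -> 0 <= y -> F (c * (y / L)) <= C * expR (L / 2) * F y.
Proof.
move=> /andP[c0 c1]; have [d Fd] := rv_doubling rvF.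
exists ((4 / c) ^+ d * d`!%:R).
  by rewrite mulr_ge0 // exprn_ge0 // divr_ge0 // ltW.
move=> L y L1 y0; have L0 : 0 < L by lra.
have [|k /andP[k1 k2]] := @exists_dyadic (L / c).
  by rewrite ler_pdivlMr // mul1r; lra.
have p2 : 0 < (2 : R) ^+ k by rewrite exprn_gt0.
apply: le_trans (_ : F (y / 2 ^+ k) <= _).
  apply: (rv_noninc rvF).
  have -> : c * (y / L) = y * (L / c)^-1 by rewrite invfM invrK; ring.
  apply: ler_wpM2l => //; rewrite lef_pV2 ?posrE ?divr_gt0 //.
apply: le_trans (rv_doubling_iter Fd k y0) _.
apply: ler_wpM2r; first exact: rv_ge0.
rewrite -exprM mulnC exprM.
apply: le_trans (_ : (2 * (L / c)) ^+ d <= _).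
  by apply: lerXn2r => //; rewrite nnegrE ?(ltW p2) // (le_trans (ltW p2)).
have -> : 2 * (L / c) = (4 / c) * (L / 2) by field; lra.
rewrite exprMn -mulrA; apply: ler_wpM2l.
  by rewrite exprn_ge0 // divr_ge0 // ltW.
by apply: power_le_expR; lra.
Qed.

Lemma conv_tail_le1 n x : conv_tail p n x <= 1.
Proof.
rewrite /conv_tail gerBl sumr_ge0 // => j _.
exact/nonneg_coefsX/(truncated_gf_ge0 pF).
Qed.

(** The exponent of the Chernoff bound at [s = L / y]. While [s k <= d / 4] the
    exponential is almost linear, hence the mean; it is at most [expR (L / 2)] for
    [k <= y / 2], and at most [expR L] for the remaining [k <= y]. *)
Lemma exp_moment_split (d L y : R) : 0 < d <= 1 -> 0 < L -> 0 < y ->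
  \sum_(0 <= k < (Num.truncn y).+1) p k * (expR (L / y * k%:R) - 1) <=
  (1 + d / 2) * (L / y) * m + expR (L / 2) * F (d / 4 * (y / L)) + expR L * F (y / 2).
Proof.
move=> d01 L0 y0; have /andP[d0 d1] := d01.
set M := Num.truncn y; set s := L / y.
have s0 : 0 < s by rewrite divr_gt0.
apply: le_trans (_ : \sum_(0 <= k < M.+1) ((1 + d / 2) * s * (p k * k%:R) +
   expR (L / 2) * (p k * (d / 4 * (y / L) < k%:R)%R%:R) +
   expR L * (p k * (y / 2 < k%:R)%R%:R)) <= _).
  apply: ler_sum_nat => k /andP[_ kM].
  have ky : k%:R <= y by rewrite -truncn_ge_nat ?ltW // -ltnS.
  have -> : (1 + d / 2) * s * (p k * k%:R) +
   expR (L / 2) * (p k * (d / 4 * (y / L) < k%:R)%R%:R) +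
   expR L * (p k * (y / 2 < k%:R)%R%:R) = p k * ((1 + d / 2) * (s * k%:R) +
   expR (L / 2) * (d / 4 * (y / L) < k%:R)%R%:R +
   expR L * (y / 2 < k%:R)%R%:R) by ring.
  apply: ler_wpM2l; first exact: (dt_ge0 pF).
  have sk0 : 0 <= s * k%:R by rewrite mulr_ge0 // ltW.
  have lin0 : 0 <= (1 + d / 2) * (s * k%:R) by rewrite mulr_ge0 //; lra.
  have e1 := expR_gt0 L; have e2 := expR_gt0 (L / 2).
  case: ltP => h1; last first.
    rewrite mulr0 addr0; apply: le_trans (expR_sub1_le d01 _) _.
      rewrite sk0 /=; apply: le_trans (_ : s * (d / 4 * (y / L)) <= _).
        by apply: ler_wpM2l => //; exact: ltW.
      rewrite le_eqVlt; apply/orP; left; apply/eqP; rewrite /s.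
      by field; rewrite !gt_eqF.
    by rewrite lerDl mulr_ge0 // ?ltW.
  rewrite mulr1; case: ltP => h2.
    rewrite mulr1; have : expR (s * k%:R) <= expR L.
      rewrite ler_expR /s mulrAC ler_pdivrMr // ler_pM2l //.
    lra.
  rewrite mulr0 addr0; have : expR (s * k%:R) <= expR (L / 2).
    by rewrite ler_expR /s mulrAC ler_pdivrMr // -mulrA ler_pM2l // mulrC.
  lra.
rewrite !big_split /= -!mulr_sumr; apply: lerD; first apply: lerD.
- by apply: ler_wpM2l => //; rewrite mulr_ge0 ?(ltW s0) //; lra.
- apply: ler_wpM2l; first exact: expR_ge0.
  apply: (dt_sum_gt pF) => [|y']; last exact: rv_ge0.
  by rewrite mulr_ge0 ?divr_ge0 // ltW.
- apply: ler_wpM2l; first exact: expR_ge0.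
  apply: (dt_sum_gt pF) => [|y']; last exact: rv_ge0.
  by rewrite divr_ge0 // ltW.
Qed.

(** The truncation level is [y = d x / 2], and [L] is such that
    [expR (- L) = n * F y]: Chernoff's bound is then of the same order as the cost
    [n * F y] of the truncation. In [exp_moment_split], multiplied by [n], the last
    two terms are bounded by constants, since [F] loses at most a power of [L]
    against [expR (L / 2)]; the first one leaves the margin [d / 2 * s * x = L]. *)
Lemma conv_tail_uniform (d : R) : 0 < d < 1 -> 0 <= m -> exists2 C : R, 0 <= C &
  forall n (x : R), 0 < x -> n%:R * m <= (1 - d) * x ->
    conv_tail p n x <= C * n%:R * F x.
Proof.
move=> /andP[d0 d1] m0.
have [D Fd] := rv_doubling rvF.
have [|C1 C10 FC1] := @rv_shrink_expR (d / 4); first by apply/andP; split; lra.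
have [|k /andP[k1 k2]] := @exists_dyadic (2 / d).
  by rewrite ler_pdivlMr // mul1r; lra.
set C2 := expR (C1 + 2 ^+ D).
exists ((expR 1 + C2) * (2 ^+ D) ^+ k).
  by rewrite mulr_ge0 ?addr_ge0 ?expR_ge0 ?exprn_ge0.
move=> n x x0 nx; set y := d / 2 * x.
have y0 : 0 < y by rewrite mulr_gt0 //; lra.
have Fyx : F y <= (2 ^+ D) ^+ k * F x.
  apply: le_trans (rv_doubling_iter Fd k (ltW x0)).
  apply: (rv_noninc rvF).
  rewrite /y ler_pdivrMr ?exprn_gt0 // mulrAC ler_peMl ?(ltW x0) //.
  by move: k1; rewrite ler_pdivrMr // mulrAC ler_pdivlMr // mul1r mulrC.
suff H : conv_tail p n x <= (expR 1 + C2) * (n%:R * F y).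
  apply: (le_trans H); rewrite -!mulrA; apply: ler_wpM2l.
    by rewrite addr_ge0 ?expR_ge0.
  by rewrite [leRHS]mulrCA; apply: ler_wpM2l.
case: n nx => [|n] nx.
  rewrite mul0r mulr0 /conv_tail expr0 big_nat_recl // coef1 eqxx.
  rewrite big1 ?addr0 ?subrr // => i _; by rewrite coef1.
set a := n.+1%:R * F y.
have a0 : 0 < a by rewrite mulr_gt0 // (rv_gt0 rvF).
have C20 : 0 < C2 by exact: expR_gt0.
have e1 : 1 <= expR 1 :> R by rewrite -expR0 ler_expR.
(* unless [n * F y] is small the bound is trivial, as a tail is at most 1 *)
case: (lerP (expR (-1)) a) => ha.
  apply: le_trans (conv_tail_le1 _ _) _.
  apply: le_trans (_ : expR 1 * a <= _); last first.
    by apply: ler_wpM2r; [exact: ltW | rewrite lerDl ltW].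
  by rewrite mulrC -ler_pdivrMr ?expR_gt0 // mul1r -expRN.
set L := - ln a.
have L1 : 1 < L by rewrite /L ltrNr -[ltRHS]expRK ltr_ln ?posrE ?expR_gt0.
have expNL : expR (- L) = a by rewrite /L opprK lnK.
have expL : expR L = a^-1 by rewrite -expNL expRN invrK.
apply: le_trans (@conv_tail_chernoff _ _ _ pF n.+1 x y (L / y) _ _ _) _.
- by rewrite ltW //= /y ler_piMl // ltW //; lra.
- by rewrite divr_ge0 //; lra.
- by move=> t; rewrite rv_ge0 (rv_le1 rvF).
rewrite -/a mulrDl; apply: lerD; first by rewrite ler_peMl // ltW.
rewrite /C2 -expNL -expRD ler_expR.
have := @exp_moment_split d L y _ _ y0; rewrite d0 (ltW d1).
have L0 : 0 < L by lra.
move=> /(_ isT L0) H.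
have {}H := ler_wpM2l (ler0n R n.+1) H.
have t1 : n.+1%:R * ((1 + d / 2) * (L / y) * m) <= L / y * ((1 - d / 2) * x).
  have -> : n.+1%:R * ((1 + d / 2) * (L / y) * m) =
     L / y * ((1 + d / 2) * (n.+1%:R * m)) by ring.
  apply: ler_wpM2l; first by rewrite divr_ge0 ?ltW.
  apply: le_trans (_ : (1 + d / 2) * ((1 - d) * x) <= _).
    by apply: ler_wpM2l => //; lra.
  rewrite mulrA; apply: ler_wpM2r; first exact: ltW.
  have := sqr_ge0 d; nra.
have t2 : n.+1%:R * (expR (L / 2) * F (d / 4 * (y / L))) <= C1.
  apply: le_trans (_ : n.+1%:R * (expR (L / 2) * (C1 * expR (L / 2) * F y)) <= _).
    apply: ler_wpM2l => //; apply: ler_wpM2l; first exact: expR_ge0.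
    by apply: FC1; exact: ltW.
  have -> : n.+1%:R * (expR (L / 2) * (C1 * expR (L / 2) * F y)) =
     C1 * (expR (L / 2) * expR (L / 2) * a) by rewrite /a; ring.
  rewrite -expRD (_ : L / 2 + L / 2 = L); last by lra.
  by rewrite expL mulVf ?mulr1 // gt_eqF.
have t3 : n.+1%:R * (expR L * F (y / 2)) <= 2 ^+ D.
  apply: le_trans (_ : n.+1%:R * (expR L * (2 ^+ D * F y)) <= _).
    apply: ler_wpM2l => //; apply: ler_wpM2l; first exact: expR_ge0.
    apply: le_trans (Fd _ _) _; first by rewrite divr_ge0 // ltW.
    by rewrite (_ : 2 * (y / 2) = y) // mulrC divfK.
  have -> : n.+1%:R * (expR L * (2 ^+ D * F y)) = 2 ^+ D * (expR L * a).
    by rewrite /a; ring.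
  by rewrite expL mulVf ?mulr1 // gt_eqF.
have sx : L / y * x = L * (2 / d).
  by rewrite /y; field; rewrite !gt_eqF.
have t1' : L / y * ((1 - d / 2) * x) = L / y * x - L.
  rewrite mulrBl mulrBr mul1r; congr (_ - _).
  by rewrite -/y divfK // gt_eqF.
rewrite !mulrDr in H; lra.
Qed.

(** The summands being nonnegative, their lower deviations are controlled by the
    mean alone: enough of it is carried by the values up to [M], on which
    [expR (- s k)] is almost linear for [s] small. *)
Lemma conv_tail_lower (d : R) (M : nat) : 0 < d < 1 -> 0 < m ->
  (1 - d / 4) * m <= \sum_(0 <= k < M.+1) p k * k%:R ->
  exists2 kappa : R, 0 < kappa &
  forall n (x : R), M%:R <= x -> x <= (1 - d) * (n%:R * m) ->
    1 - expR (- (kappa * n%:R)) <= conv_tail p n x.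
Proof.
move=> /andP[d0 d1] m0 mM.
set th := d / 4; set s : R := th / M.+1%:R.
have th01 : 0 < th < 1 by rewrite /th; apply/andP; split; lra.
have /andP[th0 th1] := th01.
have s0 : 0 < s by rewrite divr_gt0.
exists (s * m * (d / 2)); first by rewrite !mulr_gt0.
move=> n x Mx xn; rewrite /conv_tail lerD2l lerN2.
have x0 : 0 <= x by apply: le_trans Mx.
set X := Num.truncn x; set Q := truncated_gf p X.
have MX : (M <= X)%N by rewrite truncn_ge_nat.
have Q0 : nonneg_coefs (Q ^+ n) by exact/nonneg_coefsX/(truncated_gf_ge0 pF).
have z01 : 0 < expR (- s) <= 1.
  by rewrite expR_gt0 -expR0 ler_expR oppr_le0 ltW.
apply: le_trans (chernoff_lower X Q0 z01) _.
rewrite horner_exp.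
have Qz : Q.[expR (- s)] <= expR (- ((1 - th) * ((1 - th) * (s * m)))).
  apply: le_trans (expR_ge1Dx _).
  rewrite horner_truncated_gf.
  apply: le_trans (_ : \sum_(0 <= k < X.+1)
    (p k - p k * (if (k < M.+1)%N then (1 - th) * (s * k%:R) else 0)) <= _).
    apply: ler_sum_nat => k _.
    rewrite -{2}[p k]mulr1 -mulrBr; apply: ler_wpM2l; first exact: (dt_ge0 pF).
    rewrite -expRM_natl; case: ltnP => kM.
      apply: le_trans (_ : expR (- (s * k%:R)) <= _); first by rewrite mulrN mulrC.
      apply: expRN_le => //; rewrite mulr_ge0 ?(ltW s0) //= /s.
      rewrite mulrAC ler_pdivrMr // ler_pM2l // ler_nat; exact: ltnW.
    by rewrite subr0 -expR0 ler_expR mulrN oppr_le0 mulr_ge0 // ltW.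
  rewrite sumrB (dt_sum pF) (@big_cat_nat _ _ _ M.+1) //=.
  rewrite [X in _ - (_ + X)]big_nat_cond [X in _ - (_ + X)]big1; last first.
    by move=> i /andP[/andP[iM _] _]; rewrite ltnNge iM /= mulr0.
  rewrite addr0 [X in _ - X](_ : _ = (1 - th) * s * \sum_(0 <= k < M.+1) p k * k%:R).
    have := rv_ge0 X%:R.
    have : (1 - th) * s * ((1 - th) * m) <= (1 - th) * s * \sum_(0 <= k < M.+1) p k * k%:R.
      by apply: ler_wpM2l => //; rewrite mulr_ge0 ?(ltW s0) //; lra.
    by lra.
  rewrite mulr_sumr; apply: eq_big_nat => k /andP[_ kM]; rewrite kM; ring.
apply: le_trans (_ : expR (n%:R * - ((1 - th) * ((1 - th) * (s * m)))) * expR (s * x) <= _).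
  apply: ler_pM.
  - rewrite exprn_ge0 // horner_truncated_gf sumr_ge0 // => k _.
    by rewrite mulr_ge0 ?(dt_ge0 pF) // exprn_ge0 // expR_ge0.
  - by rewrite invr_ge0 exprn_ge0 // expR_ge0.
  - rewrite expRM_natl lerXn2r ?nnegrE ?expR_ge0 //.
    rewrite horner_truncated_gf sumr_ge0 // => k _.
    by rewrite mulr_ge0 ?(dt_ge0 pF) // exprn_ge0 // expR_ge0.
  - rewrite -expRM_natl -expRN ler_expR mulrN opprK mulrC; apply: ler_wpM2l.
      exact: ltW.
    by rewrite -truncn_ge_nat.
rewrite -expRD ler_expR.
have nsm : 0 <= n%:R * (s * m) by rewrite !mulr_ge0 // ltW.
have : s * x <= s * ((1 - d) * (n%:R * m)) by apply: ler_wpM2l => //; exact: ltW.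
have : 0 <= n%:R * (s * m) * (th * th) by rewrite mulr_ge0 // mulr_ge0 // ltW.
rewrite /th; nra.
Qed.

End big_jump.

(** * Asymptotics of sums and of random sums *)

Section asymptotics.
Context (R : realType) (F : R -> R) (alpha : R).
Context (rvF : rv_tail F alpha).

(** The margin [d] of the sandwich arguments: replacing [x] with [(1 - d) x] or
    [(1 + d) x] multiplies a tail by almost 1. *)
Lemma exists_near_one_scale (A p e : R) : 0 < e -> exists d : R,
  [/\ 0 < d < 1, A * (1 - d) `^ p <= A + e & A - e <= A * (1 + d) `^ p].
Proof.
move=> e0.
have /cvgrPdist_le /(_ e e0) : (fun x : R => A * x `^ p) x @[x --> (1 : R)] --> A * 1 `^ p.
  by apply: cvgM; [exact: cvg_cst | exact: powR_continuous_base].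
rewrite powR1 mulr1 => -[r /= r0 Hr].
set d := Num.min (r / 2) (1 / 2).
have d0 : 0 < d by rewrite lt_min; apply/andP; split; lra.
have dr : d <= r / 2 by rewrite ge_min lexx.
have d1 : d <= 1 / 2 by rewrite ge_min lexx orbT.
exists d; split; first by apply/andP; split; lra.
  have := Hr (1 - d); rewrite /ball_ /= opprB addrCA subrr addr0 ger0_norm ?(ltW d0) //.
  by rewrite ler_distlC => H; have /andP[] : A - e <= A * (1 - d) `^ p <= A + e by apply: H; lra.
have := Hr (1 + d); rewrite /ball_ /= opprD addrA subrr add0r normrN ger0_norm ?(ltW d0) //.
by rewrite ler_distlC => H; have /andP[] : A - e <= A * (1 + d) `^ p <= A + e by apply: H; lra.
Qed.

Lemma cvg_tail_scale (G : R -> R) (c q : R) : 0 < q -> G x / F x @[x --> +oo] --> c ->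
  G (q * x) / F x @[x --> +oo] --> c * q `^ (- alpha).
Proof.
move=> q0 Gc.
have := [elaborate cvgM (cvg_pinfty_scale q0 Gc) (rv_ratio rvF q0)].
apply: cvg_trans; apply: near_eq_cvg; near=> x.
by rewrite /= mulrA divfK // gt_eqF // (rv_gt0 rvF).
Unshelve. all: by end_near. Qed.

Lemma cvg_tail_0 (G : R -> R) (c : R) : G x / F x @[x --> +oo] --> c -> G x @[x --> +oo] --> 0.
Proof.
move=> Gc; have := [elaborate cvgM Gc (rv_cvg0 rvF)]; rewrite mulr0.
apply: cvg_trans; apply: near_eq_cvg; near=> x.
by rewrite /= divfK // gt_eqF // (rv_gt0 rvF).
Unshelve. all: by end_near. Qed.

(** Of two independent terms with a large sum, one is almost as large as the sum,
    or both are large, which is negligible. [G] and [H] are the tails of the terms,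
    [T] that of the sum. *)
Lemma tail_add_cvg (G H T : R -> R) (a b : R) :
  (forall d x, 0 < d < 1 -> 0 < x ->
     T x <= G ((1 - d) * x) + H ((1 - d) * x) + G (d * x) * H (d * x)) ->
  (forall x, 0 < x -> G x + H x - G x * H x <= T x) ->
  G x / F x @[x --> +oo] --> a -> H x / F x @[x --> +oo] --> b ->
  T x / F x @[x --> +oo] --> a + b.
Proof.
move=> Tu Tl Ga Hb; apply: cvg_pinfty_epsP => e e0.
  have e2 : 0 < e / 2 by rewrite divr_gt0.
  have [d [d01 dle _]] := exists_near_one_scale (a + b) (- alpha) e2.
  have /andP[d0 d1] := d01; have d1' : 0 < 1 - d by lra.
  have := [elaborate cvgD (cvgD (cvg_tail_scale d1' Ga) (cvg_tail_scale d1' Hb))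
    (cvgM (cvg_tail_scale d0 Ga) (cvg_pinfty_scale d0 (cvg_tail_0 Hb)))].
  move=> /cvg_pinfty_le /(_ e2); rewrite mulr0 addr0 => lim.
  near=> x.
  have x0 : 0 < x by near: x; exact: nbhs_pinfty_gt.
  have : T x / F x <= G ((1 - d) * x) / F x + H ((1 - d) * x) / F x +
     G (d * x) / F x * H (d * x).
    rewrite [_ / _ * _]mulrAC -!mulrDl ler_pM2r ?invr_gt0 ?(rv_gt0 rvF) //.
    exact: Tu.
  have : G ((1 - d) * x) / F x + H ((1 - d) * x) / F x +
     G (d * x) / F x * H (d * x) <=
     a * (1 - d) `^ (- alpha) + b * (1 - d) `^ (- alpha) + e / 2.
    by near: x; exact: lim.
  by rewrite -mulrDl; lra.
have := [elaborate cvgB (cvgD Ga Hb) (cvgM Ga (cvg_tail_0 Hb))].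
move=> /cvg_pinfty_ge /(_ e0); rewrite mulr0 subr0 => lim.
near=> x.
have x0 : 0 < x by near: x; exact: nbhs_pinfty_gt.
have : G x / F x + H x / F x - G x / F x * H x <= T x / F x.
  rewrite [_ / _ * _]mulrAC -mulrDl -mulrBl ler_pM2r ?invr_gt0 ?(rv_gt0 rvF) //.
  exact: Tl.
apply: le_trans; near: x; exact: lim.
Unshelve. all: by end_near. Qed.

Lemma cvg_sum_nat (f : nat -> R -> R) (l : nat -> R) K :
  (forall k, f k x @[x --> +oo] --> l k) ->
  \sum_(0 <= k < K) f k x @[x --> +oo] --> \sum_(0 <= k < K) l k.
Proof.
move=> fl; elim: K => [|K IH].
  by under eq_fun do rewrite big_nil; rewrite big_nil; exact: cvg_cst.
under eq_fun do rewrite big_nat_recr //=.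
by rewrite big_nat_recr //=; exact: cvgD.
Qed.

(** Here [a k] is the probability of [N = k], [s k] the tail of a sum of [k] terms,
    [GN] the tail of [N] and [T] that of the random sum. Either [N] is bounded, and
    each of its [N] terms may be the large one; or [N] is large but [N m] is below
    [x], which is negligible by the uniform bound and the finiteness of the mean of
    [N]; or [N m] exceeds [x], and then so does the sum, with high probability. *)
Lemma random_sum_tail_cvg (a : nat -> R) (s : nat -> R -> R) (GN T : R -> R)
    (c EN m : R) :
  0 < m -> 0 <= c -> (forall k, 0 <= a k) -> (forall y, 0 <= GN y) ->
  (forall y, 0 <= y -> GN y = GN (Num.truncn y)%:R) ->
  GN x / F x @[x --> +oo] --> c ->
  (forall k, s k x / F x @[x --> +oo] --> (k%:R : R)) ->
  (forall d, 0 < d < 1 -> exists2 C : R, 0 <= C &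
     forall k (x : R), 0 < x -> k%:R * m <= (1 - d) * x -> s k x <= C * k%:R * F x) ->
  (forall d, 0 < d < 1 -> exists M : R, exists2 kappa : R, 0 < kappa &
     forall n (x : R), M <= x -> x <= (1 - d) * (n%:R * m) ->
       1 - expR (- (kappa * n%:R)) <= s n x) ->
  (forall K, \sum_(0 <= k < K) a k * k%:R <= EN) ->
  (forall e, 0 < e -> exists K, EN - e <= \sum_(0 <= k < K) a k * k%:R) ->
  (forall x b, T x <= \sum_(0 <= k < b.+1) a k * s k x + GN b%:R) ->
  (forall x K n, (K <= n)%N ->
     \sum_(0 <= k < K) a k * s k x + GN n%:R * s n.+1 x <= T x) ->
  T x / F x @[x --> +oo] --> EN + c * m `^ alpha.
Proof.
move=> m0 c0 a0 GN0 GNt GNc sk unif lln ENu ENl Tu Tl.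
have mE q : 0 < q -> c * (q / m) `^ (- alpha) = c * m `^ alpha * q `^ (- alpha).
  move=> q0; rewrite powRM ?invr_ge0 ?ltW // -[in LHS](powR_inv1 (ltW m0)).
  by rewrite -powRrM mulrNN mul1r; ring.
have Kcvg K : \sum_(0 <= k < K) a k * s k x / F x @[x --> +oo] -->
   \sum_(0 <= k < K) a k * k%:R.
  apply: cvg_sum_nat => k.
  by under eq_fun do rewrite -mulrA; apply: cvgM; [exact: cvg_cst | exact: sk].
apply: cvg_pinfty_epsP => e e0.
  have e4 : 0 < e / 4 by rewrite divr_gt0.
  have [d [d01 dle _]] := exists_near_one_scale (c * m `^ alpha) (- alpha) e4.
  have [C C0 HC] := unif d d01.
  have /andP[d0 d1] := d01; have d1' : 0 < 1 - d by lra.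
  have eC : 0 < e / 4 / (C + 1) by rewrite divr_gt0 // ltr_wpDl.
  have [K HK] := ENl _ eC.
  have q0 : 0 < (1 - d) / m by rewrite divr_gt0.
  have := [elaborate cvgD (Kcvg K) (cvg_tail_scale q0 GNc)].
  rewrite mE // => /cvg_pinfty_le /(_ e4) lim.
  near=> x.
  have x0 : 0 < x by near: x; exact: nbhs_pinfty_gt.
  set b := Num.truncn ((1 - d) / m * x).
  have bx : b%:R <= (1 - d) / m * x by rewrite -truncn_ge_nat // mulr_ge0 ?ltW.
  have Kb : (K <= b.+1)%N.
    apply: leqW; rewrite truncn_ge_nat; last by rewrite mulr_ge0 ?ltW.
    by rewrite -ler_pdivrMl.
  have TF : T x / F x <= \sum_(0 <= k < K) a k * s k x / F x +
      GN ((1 - d) / m * x) / F x + C * (EN - \sum_(0 <= k < K) a k * k%:R).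
    rewrite ler_pdivrMr ?(rv_gt0 rvF) //; apply: le_trans (Tu x b) _.
    rewrite (GNt ((1 - d) / m * x)); last by rewrite mulr_ge0 ?ltW.
    rewrite -/b (@big_cat_nat _ _ _ K) //= !mulrDl mulr_suml.
    rewrite divfK ?gt_eqF ?(rv_gt0 rvF) // [leRHS]addrAC lerD2r.
    rewrite [X in _ <= X + _](eq_bigr (fun k => a k * s k x)); last first.
      by move=> k _; rewrite divfK // gt_eqF // (rv_gt0 rvF).
    rewrite lerD2l.
    apply: le_trans (_ : \sum_(K <= k < b.+1) C * F x * (a k * k%:R) <= _).
      apply: ler_sum_nat => k /andP[_ kb].
      rewrite [leRHS](_ : _ = a k * (C * k%:R * F x)); last by ring.
      apply: ler_wpM2l => //; apply: HC => //.
      rewrite -ler_pdivlMr // mulrAC; apply: le_trans bx.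
      by rewrite ler_nat -ltnS.
    rewrite -mulr_sumr [leRHS]mulrAC; apply: ler_wpM2l.
      by rewrite mulr_ge0 // ltW // (rv_gt0 rvF).
    rewrite lerBrDl -big_cat_nat //.
  have : C * (EN - \sum_(0 <= k < K) a k * k%:R) <= e / 4.
    apply: le_trans (_ : C * (e / 4 / (C + 1)) <= _).
      by apply: ler_wpM2l => //; lra.
    by rewrite mulrA ler_pdivrMr ?ltr_wpDl // mulrC ler_pM2l // lerDl.
  have : \sum_(0 <= k < K) a k * s k x / F x + GN ((1 - d) / m * x) / F x <=
     \sum_(0 <= k < K) a k * k%:R + c * m `^ alpha * (1 - d) `^ (- alpha) + e / 4.
    by near: x; exact: lim.
  have := ENu K; lra.
have e4 : 0 < e / 4 by rewrite divr_gt0.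
have [d [d01 _ dge]] := exists_near_one_scale (c * m `^ alpha) (- alpha) e4.
have /andP[d0 d1] := d01; have d1' : 0 < 1 + d by lra.
have [|M [kappa k0 HM]] := lln (d / 2); first by apply/andP; split; lra.
have [K HK] := ENl _ e4.
have q0 : 0 < (1 + d) / m by rewrite divr_gt0.
have kq0 : 0 < kappa * ((1 + d) / m) by rewrite mulr_gt0.
(* bounds from below the probability that [(1 + d) x / m] terms add up to [x] *)
have expc : 1 - expR (- (kappa * ((1 + d) / m) * x)) @[x --> +oo] --> (1 - 0 : R).
  by apply: cvgB; [exact: cvg_cst | exact: (cvg_pinfty_scale kq0 (@cvgr_expR R))].
have := [elaborate cvgD (Kcvg K) (cvgM (cvg_tail_scale q0 GNc) expc)].
rewrite mE // subr0 mulr1 => /cvg_pinfty_ge /(_ e4) lim.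
near=> x.
have x0 : 0 < x by near: x; exact: nbhs_pinfty_gt.
set n := Num.truncn ((1 + d) / m * x).
have nx : (1 + d) / m * x <= n.+1%:R by exact/ltW/truncnS_gt.
have Kn : (K <= n)%N.
  rewrite truncn_ge_nat; last by rewrite mulr_ge0 ?ltW.
  by rewrite -ler_pdivrMl.
have TF : \sum_(0 <= k < K) a k * s k x / F x +
   GN ((1 + d) / m * x) / F x * (1 - expR (- (kappa * ((1 + d) / m) * x))) <= T x / F x.
  rewrite ler_pdivlMr ?(rv_gt0 rvF) //; apply: le_trans (Tl x K n Kn).
  rewrite mulrDl mulr_suml; apply: lerD.
    apply: ler_sum => k _; by rewrite divfK // gt_eqF // (rv_gt0 rvF).
  rewrite mulrAC divfK ?gt_eqF ?(rv_gt0 rvF) //.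
  rewrite (GNt ((1 + d) / m * x)); last by rewrite mulr_ge0 ?ltW.
  apply: ler_wpM2l => //.
  apply: le_trans (HM n.+1 x _ _).
  - rewrite lerD2l lerN2 ler_expR lerN2 -mulrA.
    by apply: ler_wpM2l => //; exact: ltW.
  - by near: x; apply: nbhs_pinfty_ge; exact: num_real.
  - apply: le_trans (_ : (1 - d / 2) * ((1 + d) / m * x * m) <= _); last first.
      by apply: ler_wpM2l; [lra | apply: ler_wpM2r => //; exact: ltW].
    rewrite (_ : (1 + d) / m * x * m = (1 + d) * x); last by field; exact: lt0r_neq0.
    rewrite mulrA ler_peMl ?(ltW x0) //; nra.
have : \sum_(0 <= k < K) a k * k%:R + c * m `^ alpha * (1 + d) `^ (- alpha) - e / 4 <=
  \sum_(0 <= k < K) a k * s k x / F x +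
   GN ((1 + d) / m * x) / F x * (1 - expR (- (kappa * ((1 + d) / m) * x))).
  by near: x; exact: lim.
lra.
Unshelve. all: by end_near. Qed.

End asymptotics.

(** * Events independent of a family of variables *)

Section real_probability.
Context (disp : measure_display) (T : measurableType disp) (R : realType) (P : probability T R).
Implicit Types (A B : set T) (U V N : T -> nat).

Definition pr A : R := fine (P A).

Lemma prE A : measurable A -> P A = (pr A)%:E.
Proof. by move=> mA; rewrite fineK // fin_num_measure. Qed.

Lemma pr_ge0 A : 0 <= pr A. Proof. by rewrite fine_ge0. Qed.

Lemma pr_le A B : measurable A -> measurable B -> A `<=` B -> pr A <= pr B.
Proof.
move=> mA mB AB; rewrite fine_le ?fin_num_measure //.
by apply: le_measure; rewrite ?inE.
Qed.

Lemma pr_setT : pr setT = 1.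
Proof. by rewrite /pr probability_setT. Qed.

Lemma pr_le1 A : measurable A -> pr A <= 1.
Proof. by move=> mA; rewrite -pr_setT pr_le. Qed.

Lemma pr_setU A B : measurable A -> measurable B -> A `&` B = set0 ->
  pr (A `|` B) = pr A + pr B.
Proof. by move=> mA mB AB; rewrite /pr measureU // fineD ?fin_num_measure. Qed.

Lemma pr_setID A B : measurable A -> measurable B ->
  pr A = pr (A `&` B) + pr (A `&` ~` B).
Proof.
move=> mA mB; rewrite -pr_setU.
- by rewrite -setIUr setUv setIT.
- exact: measurableI.
- by apply: measurableI => //; exact: measurableC.
- by rewrite setIACA setICr setI0.
Qed.

Lemma pr_setU_le A B : measurable A -> measurable B -> pr (A `|` B) <= pr A + pr B.
Proof.
move=> mA mB; rewrite (@pr_setID (A `|` B) A) //; last exact: measurableU.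
rewrite setUK lerD2l; apply: pr_le => //.
  by apply: measurableI; [exact: measurableU | exact: measurableC].
by move=> w [[|//] ?]; contradiction.
Qed.

Lemma pr_setU_setI A B : measurable A -> measurable B ->
  pr (A `|` B) = pr A + pr B - pr (A `&` B).
Proof.
move=> mA mB; rewrite (@pr_setID (A `|` B) A) //; last exact: measurableU.
rewrite setUK setIUl setICr set0U (@pr_setID B A) // [B `&` A]setIC; ring.
Qed.

Lemma pr_setC A : measurable A -> pr (~` A) = 1 - pr A.
Proof.
move=> mA; rewrite -pr_setT (@pr_setID setT A) // !setTI; ring.
Qed.

Definition measurable_levels N := forall B : set nat, measurable (N @^-1` B).

Lemma pr_levels A N K : measurable A -> measurable_levels N ->
  pr (A `&` [set w | (N w < K)%N]) = \sum_(0 <= k < K) pr (A `&` N @^-1` [set k]).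
Proof.
move=> mA mN; elim: K => [|K IH].
  by rewrite big_nil (_ : _ `&` _ = set0) ?/pr ?measure0 // -subset0 => w [].
rewrite big_nat_recr //= -IH -pr_setU.
- congr pr; apply/seteqP; split=> w /=.
    by move=> [Aw]; rewrite ltnS leq_eqVlt => /orP[/eqP|] ?; [right|left].
  by move=> [[Aw /ltnW]|[Aw ->]]; rewrite ltnS.
- by apply: measurableI => //; exact: (mN [set k | (k < K)%N]).
- exact: measurableI.
- by rewrite -subset0 => w /= [[_ h1] [_ h2]]; move: h1; rewrite h2 ltnn.
Qed.

Lemma P_levels A N : measurable A -> measurable_levels N ->
  P A = (\sum_(0 <= k <oo) P (A `&` N @^-1` [set k]))%E.
Proof.
move=> mA mN; rewrite -measure_semi_bigcup.
- congr (P _); apply/seteqP; split=> w; first by move=> Aw; exists (N w).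
  by move=> [? _ []].
- by move=> k; apply: measurableI.
- by apply/trivIsetP => i j _ _ ij; rewrite -subset0 => w /= [[_ h1] [_ h2]];
    move: ij; rewrite -h1 -h2 eqxx.
- by apply: bigcup_measurable => k _; exact: measurableI.
Qed.

Definition nat_tail U (x : R) : R := pr [set w | x < (U w)%:R].

Lemma nat_tail_truncn U x : 0 <= x -> nat_tail U x = nat_tail U (Num.truncn x)%:R.
Proof.
move=> x0; congr pr; apply/seteqP; split=> w /=;
  by rewrite ltr_nat truncn_lt_nat.
Qed.

Lemma nat_tail_le U x y : measurable_levels U -> x <= y ->
  nat_tail U y <= nat_tail U x.
Proof.
move=> mU xy; apply: pr_le; [exact: (mU [set k | y < k%:R])| exact: (mU [set k | x < k%:R])|].
by move=> w /=; exact: le_lt_trans.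
Qed.

Lemma nat_tail_ge0 U x : 0 <= nat_tail U x. Proof. exact: pr_ge0. Qed.

(** The hypotheses of [tail_add_cvg]: the upper bound comes from a union of three
    events, the lower one from inclusion and exclusion. *)
Lemma nat_tail_add U V : measurable_levels U -> measurable_levels V ->
  (forall a b : R, pr ([set w | a < (U w)%:R] `&` [set w | b < (V w)%:R]) =
     nat_tail U a * nat_tail V b) ->
  (forall d x : R, 0 < d < 1 -> 0 < x ->
     nat_tail (fun w => U w + V w)%N x <=
       nat_tail U ((1 - d) * x) + nat_tail V ((1 - d) * x) +
       nat_tail U (d * x) * nat_tail V (d * x)) /\
  (forall x : R, 0 < x -> nat_tail U x + nat_tail V x - nat_tail U x * nat_tail V x <=
     nat_tail (fun w => U w + V w)%N x).
Proof.
move=> mU mV UV.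
have mUx (x : R) : measurable [set w | x < (U w)%:R] by exact: (mU [set k | x < k%:R]).
have mVx (x : R) : measurable [set w | x < (V w)%:R] by exact: (mV [set k | x < k%:R]).
have mUV (x : R) : measurable [set w | x < (U w + V w)%:R].
  rewrite (_ : [set _ | _] = \bigcup_i (U @^-1` [set i] `&` V @^-1` [set j | x < (i + j)%:R])).
    by apply: bigcup_measurable => i _; apply: measurableI.
  apply/seteqP; split=> w /=; first by move=> h; exists (U w).
  by move=> [i _ [/= <-]].
split=> [d x /andP[d0 d1] x0|x x0]; rewrite -UV.
  apply: le_trans (_ : pr ([set w | (1 - d) * x < (U w)%:R] `|` [set w | (1 - d) * x < (V w)%:R]
    `|` ([set w | d * x < (U w)%:R] `&` [set w | d * x < (V w)%:R])) <= _).
    apply: pr_le => //.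
      apply: measurableU; [exact: measurableU | exact: measurableI].
    move=> w /=; rewrite natrD => h.
    case: (ltP ((1 - d) * x) (U w)%:R) => hU; first by left; left.
    case: (ltP ((1 - d) * x) (V w)%:R) => hV; first by left; right.
    by right; split; lra.
  apply: le_trans (pr_setU_le _ _) _.
  - exact: measurableU.
  - exact: measurableI.
  - by rewrite lerD2r; apply: pr_setU_le.
rewrite -pr_setU_setI //; apply: pr_le => //; first exact: measurableU.
by move=> w /= [h|h]; apply: (lt_le_trans h); rewrite ler_nat ?leq_addr ?leq_addl.
Qed.

End real_probability.

Section independent_events.
Context (disp : measure_display) (T : measurableType disp) (R : realType) (P : probability T R).
Context (I : choiceType) (Z : I -> {RV P >-> nat}).
Implicit Types (D : set I) (E : set T) (B : set nat) (U : T -> nat).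

(** The product rule of mutual independence with the additional factor [P E]. It makes
    [E] independent of the subfamily [D] jointly, and it is the property that one
    generation hands on to the next. *)
Definition event_independent D E := measurable E /\
  forall J : {fset I}, [set` J] `<=` D -> forall A : I -> set nat,
    P (E `&` \bigcap_(i in [set` J]) (Z i @^-1` A i)) =
    (P E * \prod_(i <- J) P (Z i @^-1` A i))%E.

Lemma measurable_levels_RV (X : {RV P >-> nat}) : measurable_levels X.
Proof. by move=> B; rewrite -[_ @^-1` _]setTI; exact: measurable_funP. Qed.

Lemma event_independentW D D' E : D' `<=` D -> event_independent D E ->
  event_independent D' E.
Proof. by move=> sD [mE iE]; split=> // J JD; apply: iE; exact: subset_trans sD. Qed.

(** The sure event is the one from which all others are built. *)
Lemma mutually_independent_setT D : mutually_independent D Z ->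
  event_independent D setT.
Proof.
move=> iZ; split=> // J JD A.
by rewrite setTI probability_setT mul1e; apply: iZ.
Qed.

Lemma event_independent_bigcup D (E : nat -> set T) : trivIset setT E ->
  (forall n, event_independent D (E n)) -> event_independent D (\bigcup_n E n).
Proof.
move=> tE iE; have mE n : measurable (E n) by have [] := iE n.
have mUE : measurable (\bigcup_n E n) by exact: bigcup_measurable.
split=> // J JD A.
set C := \bigcap_(i in _) _.
have mC : measurable C.
  apply: fin_bigcap_measurable; first exact: finite_fset.
  by move=> i _; exact: measurable_levels_RV.
set c := (\prod_(i <- J) _)%E.
have c0 : (0 <= c)%E by apply: prode_ge0 => i _.
have cE n : P (E n `&` C) = (c * P (E n))%E by rewrite muleC; have [_] := iE n; apply.
have cfin : c \is a fin_num.
  by apply: prode_fin_num => i _; rewrite fin_num_measure //; exact: measurable_levels_RV.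
rewrite setI_bigcupl measure_semi_bigcup //.
- rewrite (eq_eseriesr (fun n _ => cE n)).
  by rewrite -(fineK cfin) nneseriesZl // measure_semi_bigcup // muleC.
- by move=> n; exact: measurableI.
- by apply: trivIset_setIr.
- by apply: bigcup_measurable => n _; exact: measurableI.
Qed.

(** The variable [j] leaves the family, since the new event depends on it. *)
Lemma event_independent_setI D E j B : event_independent D E -> D j ->
  event_independent (D `\ j) (E `&` Z j @^-1` B) /\
  P (E `&` Z j @^-1` B) = (P E * P (Z j @^-1` B))%E.
Proof.
move=> [mE iE] Dj.
have PE : P (E `&` Z j @^-1` B) = (P E * P (Z j @^-1` B))%E.
  have := iE [fset j]%fset; rewrite set_fset1 => /(_ _ (fun=> B)).
  by rewrite bigcap_set1 big_seq_fset1; apply => i ->.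
split=> //; split; first by apply: measurableI => //; exact: measurable_levels_RV.
move=> J JD A.
have jJ : j \notin J by apply/negP => jJ; have [_] := JD j jJ; apply.
pose A' i := if i == j then B else A i.
have A'E i : i \in J -> A' i = A i.
  by move=> iJ; rewrite /A'; case: eqP => // ij; move: jJ; rewrite -ij iJ.
have JD' : [set` (j |` J)%fset] `<=` D.
  by move=> i /=; rewrite !inE => /orP[/eqP -> //|/JD []].
have := iE (j |` J)%fset JD' A'.
rewrite bigcap_fsetU1 big_fsetU1 //= {1 3}/A' eqxx setIA muleA -PE.
rewrite (eq_bigcapr (fun i iJ => congr1 (fun X => Z i @^-1` X) (A'E i iJ))) => ->.
by congr (_ * _)%E; apply: eq_big_seq => i /A'E ->.
Qed.

(** The event is split along the value of [U], after which it concerns [Z j]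
    alone. *)
Lemma event_independent_add D E U j : D j ->
  (forall B, event_independent D (E `&` U @^-1` B)) ->
  forall B, event_independent (D `\ j) (E `&` (fun w => U w + Z j w)%N @^-1` B).
Proof.
move=> Dj iU B.
rewrite (_ : _ `&` _ = \bigcup_i ((E `&` U @^-1` [set i]) `&` Z j @^-1` [set k | B (i + k)%N])).
  apply: event_independent_bigcup.
    by apply/trivIsetP => i k _ _ ik; rewrite -subset0 => w /= [[[_ h1] _] [[_ h2] _]];
      move: ik; rewrite -h1 -h2 eqxx.
  by move=> i; have [] := @event_independent_setI D _ j [set k | B (i + k)%N] (iU [set i]) Dj.
apply/seteqP; split=> w /=; first by move=> [Ew Bw]; exists (U w).
by move=> [i _ [[Ew <-] Bw]].
Qed.

End independent_events.

(** * Means of counting variables *)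

Section nat_means.
Context (disp : measure_display) (T : measurableType disp) (R : realType)
  (P : probability T R).
Implicit Types (E : set T) (U : T -> nat).

Lemma measurable_fun_levels U E : measurable_levels U ->
  measurable_fun E (fun w => ((U w)%:R : R)%:E).
Proof.
move=> mU; apply: measurable_funTS; apply/measurable_EFinP.
apply: (@measurableT_comp _ _ _ _ _ _ (@natR R) _ U) => // _ B mB.
by rewrite setTI; exact: mU.
Qed.

Lemma integral_levels U E : measurable E -> measurable_levels U ->
  (\int[P]_(w in E) (U w)%:R%:E =
   \sum_(0 <= k <oo) k%:R%:E * P (E `&` U @^-1` [set k]))%E.
Proof.
move=> mE mU.
have {1}-> : E = \bigcup_k (E `&` U @^-1` [set k]).
  apply/seteqP; split=> w; first by move=> Ew; exists (U w).
  by move=> [? _ []].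
have mEk k : measurable (E `&` U @^-1` [set k]) by exact: measurableI.
rewrite ge0_integral_bigcup //.
- apply: eq_eseriesr => k _; rewrite -integral_cst //.
  by apply: eq_integral => w; rewrite inE => -[_ <-].
- by apply: measurable_fun_levels.
- by apply/trivIsetP => i j _ _ ij; rewrite -subset0 => w /= [[_ h1] [_ h2]];
    move: ij; rewrite -h1 -h2 eqxx.
Qed.

Definition nat_mean U : \bar R := (\int[P]_w (U w)%:R%:E)%E.

Lemma nat_mean_ge0 U : (0 <= nat_mean U)%E.
Proof. by apply: integral_ge0 => w _; rewrite lee_fin. Qed.

Lemma nat_mean_levels U : measurable_levels U ->
  nat_mean U = (\sum_(0 <= k <oo) k%:R%:E * P (U @^-1` [set k]))%E.
Proof.
move=> mU; rewrite /nat_mean integral_levels //.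
by apply: eq_eseriesr => k _; rewrite setTI.
Qed.

Lemma nat_mean_partial U K : measurable_levels U ->
  (\sum_(0 <= k < K) k%:R%:E * P (U @^-1` [set k]))%E =
  (\sum_(0 <= k < K) pr P (U @^-1` [set k]) * k%:R)%:E.
Proof.
move=> mU; rewrite -sumEFin; apply: eq_bigr => k _.
by rewrite prE // -EFinM mulrC.
Qed.

Lemma nat_mean_ge_partial U e : measurable_levels U -> nat_mean U = e%:E ->
  forall K, \sum_(0 <= k < K) pr P (U @^-1` [set k]) * k%:R <= e.
Proof.
move=> mU Ue K; rewrite -lee_fin -Ue -nat_mean_partial // nat_mean_levels //.
by apply: nneseries_lim_ge => k _ _; rewrite mule_ge0 ?lee_fin.
Qed.

Lemma nat_mean_approx U m e : measurable_levels U -> nat_mean U = m%:E -> 0 < e ->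
  exists K, m - e <= \sum_(0 <= k < K) pr P (U @^-1` [set k]) * k%:R.
Proof.
move=> mU Ue e0; apply: contrapT => /forallNP H.
suff : (nat_mean U <= (m - e)%:E)%E by rewrite Ue lee_fin; lra.
rewrite nat_mean_levels //; apply: lime_le.
  by apply: is_cvg_nneseries => k _ _; rewrite mule_ge0 ?lee_fin.
near=> K; rewrite nat_mean_partial // lee_fin ltW // ltNge.
exact/negP/H.
Unshelve. all: by end_near. Qed.

(** By Abel summation the partial sums of [k * P (U = k)] are below those of the
    tails. *)
Lemma nat_mean_fin U B : measurable_levels U ->
  (forall K, \sum_(0 <= k < K) nat_tail P U k%:R <= B) ->
  (nat_mean U < +oo)%E.
Proof.
move=> mU HB.
apply: (@le_lt_trans _ _ B%:E); last exact: ltry.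
rewrite nat_mean_levels //; apply: lime_le.
  by apply: is_cvg_nneseries => k _ _; rewrite mule_ge0 ?lee_fin.
have abel K : \sum_(0 <= k < K.+1) pr P (U @^-1` [set k]) * k%:R + K%:R * nat_tail P U K%:R =
    \sum_(0 <= k < K) nat_tail P U k%:R.
  elim: K => [|K IH]; first by rewrite big_nat1 big_nil mulr0 mul0r addr0.
  rewrite big_nat_recr //= [RHS]big_nat_recr //= -IH.
  have -> : nat_tail P U K%:R = pr P (U @^-1` [set K.+1]) + nat_tail P U K.+1%:R.
    rewrite /nat_tail (@pr_setID _ _ _ P [set w | K%:R < (U w)%:R] (U @^-1` [set K.+1])) //.
      congr (pr P _ + pr P _); apply/seteqP; split=> w /=.
      - by case.
      - by move=> ->; rewrite ltr_nat.
      - by rewrite !ltr_nat => -[h1 h2]; lia.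
      - by rewrite !ltr_nat => h1; split; lia.
    exact: (mU [set k | K%:R < k%:R :> R]).
  rewrite -!natr1; ring.
near=> K; rewrite nat_mean_partial // lee_fin.
apply: le_trans (HB K); rewrite -abel.
apply: le_trans (_ : \sum_(0 <= k < K.+1) pr P (U @^-1` [set k]) * k%:R <= _).
  by rewrite big_nat_recr //= lerDl mulr_ge0 // pr_ge0.
by rewrite lerDl mulr_ge0 // nat_tail_ge0.
Unshelve. all: by end_near. Qed.

End nat_means.

(** * Partial sums of an independent sequence *)

Section partial_sums.
Context (disp : measure_display) (T : measurableType disp) (R : realType)
  (P : probability T R) (I : choiceType) (Z : I -> {RV P >-> nat}).
Context (D : set I) (b : nat -> I).
Context (b_inj : injective b) (Db : forall i, D (b i)).
Context (indT : event_independent Z D setT).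
Implicit Types (E : set T) (B : set nat).

Definition partial_sum k w : nat := (\sum_(0 <= i < k) Z (b i) w)%N.

Lemma partial_sumS k : partial_sum k.+1 = (fun w => partial_sum k w + Z (b k) w)%N.
Proof. by apply/funext => w; rewrite /partial_sum big_nat_recr. Qed.

Lemma partial_sum_le k l w : (k <= l)%N -> (partial_sum k w <= partial_sum l w)%N.
Proof. by move=> kl; rewrite /partial_sum (big_cat_nat _ kl) //= leq_addr. Qed.

(* the indices consumed by the first [k] summands *)
Let used k : set I := [set b i | i in `I_k].

Lemma unused_next k : (D `\` used k) (b k).
Proof. by split=> // -[i /= ik /b_inj ik']; rewrite ik' ltnn in ik. Qed.

Lemma partial_sum_independent k E B : event_independent Z D E ->
  event_independent Z (D `\` used k) (E `&` partial_sum k @^-1` B).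
Proof.
move=> iE; elim: k B => [|k IH] B.
  have iE' : event_independent Z (D `\` used 0) E.
    by apply: event_independentW iE => i [].
  have [B0|B0] := pselect (B 0%N).
    rewrite (_ : _ `&` _ = E) //; apply/seteqP; split=> w; first by case.
    by move=> Ew; split=> //=; rewrite /partial_sum big_nil.
  rewrite (_ : _ `&` _ = set0); last first.
    by rewrite -subset0 => w [_ /=]; rewrite /partial_sum big_nil.
  by split=> // J _ A; rewrite set0I !measure0 mul0e.
rewrite partial_sumS.
apply: event_independentW (event_independent_add (unused_next k) IH B) => i [Di iu].
split; first by split=> // -[l /= lk li]; apply: iu; exists l => //=; exact: ltnW.
by move=> /= ik; apply: iu; exists k => /=.
Qed.

Lemma measurable_partial_sum k : measurable_levels (partial_sum k).
Proof.
by move=> B; have [] := partial_sum_independent k B indT; rewrite setTI.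
Qed.

Lemma measurable_setI_partial_sum k E B : measurable E ->
  measurable (E `&` partial_sum k @^-1` B).
Proof. by move=> mE; apply: measurableI => //; exact: measurable_partial_sum. Qed.

Lemma setI_partial_sumS k E B i :
  E `&` partial_sum k.+1 @^-1` B `&` partial_sum k @^-1` [set i] =
  (E `&` partial_sum k @^-1` [set i]) `&` Z (b k) @^-1` [set j | B (i + j)%N].
Proof.
rewrite partial_sumS; apply/seteqP; split=> w /=.
  by move=> [[Ew Bw] <-].
by move=> [[Ew <-] Bw].
Qed.

Lemma partial_sum_next k E B i : event_independent Z D E ->
  P (E `&` partial_sum k.+1 @^-1` B `&` partial_sum k @^-1` [set i]) =
  (P (E `&` partial_sum k @^-1` [set i]) * P (Z (b k) @^-1` [set j | B (i + j)%N]))%E.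
Proof.
move=> iE; rewrite setI_partial_sumS.
by have [] := event_independent_setI [set j | B (i + j)%N]
  (partial_sum_independent k [set i] iE) (unused_next k).
Qed.

(** The induction runs over all [B]: the last summand is integrated out against
    each value of the preceding sum. *)
Lemma partial_sum_prod k E B : event_independent Z D E ->
  P (E `&` partial_sum k @^-1` B) = (P E * P (partial_sum k @^-1` B))%E.
Proof.
move=> iE; have mE : measurable E by case: iE.
elim: k B => [|k IH] B.
  have [B0|B0] := pselect (B 0%N).
    have -> : partial_sum 0 @^-1` B = setT.
      by apply/seteqP; split=> // w _ /=; rewrite /partial_sum big_nil.
    by rewrite setIT probability_setT mule1.
  have -> : partial_sum 0 @^-1` B = set0.
    by rewrite -subset0 => w /=; rewrite /partial_sum big_nil.
  by rewrite setI0 measure0 mule0.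
rewrite (@P_levels _ _ _ P _ (partial_sum k)); last exact: measurable_partial_sum.
  rewrite [in RHS](@P_levels _ _ _ P (partial_sum k.+1 @^-1` B) (partial_sum k));
    first last.
  - exact: measurable_partial_sum.
  - exact: measurable_partial_sum.
  rewrite (prE P mE) -nneseriesZl; last by move=> i _.
  apply: eq_eseriesr => i _; rewrite partial_sum_next // IH -muleA -(prE P mE).
  by congr (_ * _)%E; have := partial_sum_next k B i indT; rewrite !setTI.
exact: measurable_setI_partial_sum.
Qed.

Context (p : nat -> R) (lawp : forall i k, pr P (Z (b i) @^-1` [set k]) = p k).

(** The generating function of a sum is the product of those of its terms; the
    truncation at [M] is harmless up to degree [M]. *)
Lemma partial_sum_law k M j : (j <= M)%N ->
  pr P (partial_sum k @^-1` [set j]) = (truncated_gf p M ^+ k)`_j.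
Proof.
elim: k j => [|k IH] j jM.
  rewrite expr0 coef1; case: eqP => j0.
    rewrite (_ : _ @^-1` _ = setT) ?pr_setT //.
    by apply/seteqP; split=> // w _ /=; rewrite /partial_sum big_nil j0.
  rewrite (_ : _ @^-1` _ = set0) ?/pr ?measure0 // -subset0 => w /=.
  by rewrite /partial_sum big_nil => /esym.
have -> : partial_sum k.+1 @^-1` [set j] =
    partial_sum k.+1 @^-1` [set j] `&` [set w | (partial_sum k w < j.+1)%N].
  apply/seteqP; split=> w /=; last by case.
  by move=> h; split=> //; rewrite ltnS -h partial_sum_le.
rewrite pr_levels //; [|exact: measurable_partial_sum|exact: measurable_partial_sum].
rewrite exprSr coefM big_mkord; apply: eq_bigr => i _.
have ij : (i <= j)%N by rewrite -ltnS.
rewrite -IH ?(leq_trans ij) //.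
have := partial_sum_next k [set j] i indT; rewrite !setTI => /(congr1 fine).
rewrite fineM ?fin_num_measure //; first last.
- exact: measurable_levels_RV.
- exact: measurable_partial_sum.
rewrite -!/(pr P _) => ->; congr (_ * _).
rewrite coef_poly ltnS (leq_trans (leq_subr _ _) jM) -(lawp k).
congr pr; apply/seteqP; split=> w /=; lia.
Qed.

Lemma nat_tail_partial_sum k x : 0 <= x ->
  nat_tail P (partial_sum k) x = conv_tail p k x.
Proof.
move=> x0; rewrite /conv_tail.
rewrite (eq_big_nat _ _ (F2 := fun j => pr P (setT `&` partial_sum k @^-1` [set j]))).
  rewrite -pr_levels //; last exact: measurable_partial_sum.
  rewrite setTI -pr_setC.
    congr pr; apply/seteqP; split=> w /=.
      by rewrite -truncn_lt_nat // => h; apply/negP; rewrite -leqNgt.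
    by move=> /negP; rewrite -leqNgt truncn_lt_nat.
  exact: (measurable_partial_sum k [set j | (j < (Num.truncn x).+1)%N]).
move=> j /andP[_ jx]; rewrite setTI (@partial_sum_law k (Num.truncn x)) //.
Qed.

End partial_sums.

(** * Random sums with immigration *)

Section random_sums.
Context (disp : measure_display) (T : measurableType disp) (R : realType)
  (P : probability T R) (I : choiceType) (Z : I -> {RV P >-> nat}).
Context (D : set I) (b : nat -> I) (j : I).
Context (b_inj : injective b) (Db : forall i, D (b i)) (Dj : D j)
  (jb : ~ range b j).
Context (indT : event_independent Z D setT).
Context (N : T -> nat) (indN : forall B, event_independent Z D (N @^-1` B)).

Let S := partial_sum Z b.
Let random_sum w := S (N w) w.
Let mN : measurable_levels N. Proof. by move=> B; case: (indN B). Qed.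
Let mS k : measurable_levels (S k).
Proof. exact: measurable_partial_sum b_inj Db indT k. Qed.

Lemma random_sum_independent B :
  event_independent Z (D `\` range b) (random_sum @^-1` B).
Proof.
rewrite (_ : _ @^-1` _ = \bigcup_k (N @^-1` [set k] `&` S k @^-1` B)).
  apply: event_independent_bigcup.
    by apply/trivIsetP => i k _ _ ik; rewrite -subset0 => w /= [[h1 _] [h2 _]];
      move: ik; rewrite -h1 -h2 eqxx.
  move=> k.
  apply: event_independentW (partial_sum_independent b_inj Db k B (indN [set k])).
  by move=> i [Di ib]; split=> // -[l _ li]; apply: ib; exists l.
apply/seteqP; split=> w /=; first by move=> Bw; exists (N w).
by move=> [k _ [/= <-]].
Qed.

Let mSN : measurable_levels random_sum.
Proof. by move=> B; case: (random_sum_independent B). Qed.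

Definition sum_with_immigration w := (random_sum w + Z j w)%N.

Lemma sum_with_immigration_independent B :
  event_independent Z ((D `\` range b) `\ j) (sum_with_immigration @^-1` B).
Proof.
rewrite -[X in event_independent _ _ X]setTI.
apply: event_independent_add => // C; rewrite setTI.
exact: random_sum_independent.
Qed.

Let mY : measurable_levels sum_with_immigration.
Proof. by move=> B; case: (sum_with_immigration_independent B). Qed.

Lemma levels_partial_sum_prod A k B :
  pr P (N @^-1` A `&` S k @^-1` B) = pr P (N @^-1` A) * pr P (S k @^-1` B).
Proof.
have := partial_sum_prod b_inj Db indT k B (indN A) => /(congr1 fine).
by rewrite fineM ?fin_num_measure //; exact: mS.
Qed.

Lemma random_sum_levels x K :
  pr P ([set w | x < (random_sum w)%:R] `&` [set w | (N w < K)%N]) =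
  \sum_(0 <= k < K) pr P (N @^-1` [set k]) * nat_tail P (S k) x.
Proof.
rewrite pr_levels //; last exact: (mSN [set k | x < k%:R]).
apply: eq_big_nat => k _.
rewrite -(levels_partial_sum_prod _ k [set i | x < i%:R]); congr pr.
apply/seteqP; split=> w /=; first by move=> [h <-].
by move=> [Nk h]; split=> //; rewrite /random_sum Nk.
Qed.

Lemma random_sum_tail_upper x K : nat_tail P random_sum x <=
  \sum_(0 <= k < K.+1) pr P (N @^-1` [set k]) * nat_tail P (S k) x +
  nat_tail P N K%:R.
Proof.
rewrite -random_sum_levels /nat_tail.
rewrite (@pr_setID _ _ _ P _ [set w | (N w < K.+1)%N]); first last.
- exact: (mN [set k | (k < K.+1)%N]).
- exact: (mSN [set k | x < k%:R]).
rewrite lerD2l; apply: pr_le.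
- apply: measurableI; first exact: (mSN [set k | x < k%:R]).
  exact/measurableC/(mN [set k | (k < K.+1)%N]).
- exact: (mN [set k | K%:R < k%:R :> R]).
- by move=> w [_ /= /negP]; rewrite ltr_nat -leqNgt.
Qed.

(** When [N] exceeds [n], the random sum is at least the sum of [n + 1] terms, and
    these are independent of [N]. *)
Lemma random_sum_tail_lower x K n : (K <= n)%N ->
  \sum_(0 <= k < K) pr P (N @^-1` [set k]) * nat_tail P (S k) x +
  nat_tail P N n%:R * nat_tail P (S n.+1) x <= nat_tail P random_sum x.
Proof.
move=> Kn; rewrite -random_sum_levels {3}/nat_tail.
rewrite (@pr_setID _ _ _ P [set w | x < (random_sum w)%:R] [set w | (N w < K)%N]);
  first last.
- exact: (mN [set k | (k < K)%N]).
- exact: (mSN [set k | x < k%:R]).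
rewrite lerD2l -(levels_partial_sum_prod [set k | n%:R < k%:R :> R] n.+1 [set i | x < i%:R]).
apply: pr_le.
- by apply: measurableI; [exact: mN | exact: mS].
- apply: measurableI; first exact: (mSN [set k | x < k%:R]).
  exact/measurableC/(mN [set k | (k < K)%N]).
move=> w [/=]; rewrite ltr_nat => nN xS; split.
  apply: (lt_le_trans xS); rewrite ler_nat.
  by rewrite /random_sum partial_sum_le.
by apply/negP; rewrite -leqNgt (leq_trans Kn) // ltnW.
Qed.

Section tails.
Context (F : R -> R) (p : nat -> R) (alpha m : R).
Context (rvF : rv_tail F alpha) (pF : discrete_tail p F) (m0 : 0 < m).
Context (lawp : forall i k, pr P (Z (b i) @^-1` [set k]) = p k).
Context (tailF : forall i x, nat_tail P (Z (b i)) x = F x).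
Context (meanZ : forall i, nat_mean P (Z (b i)) = m%:E).

Let mZ i : measurable_levels (Z i). Proof. exact: measurable_levels_RV. Qed.

Lemma nat_tail_product U D0 i : D0 i ->
  (forall B, event_independent Z D0 (U @^-1` B)) -> forall x y : R,
  pr P ([set w | x < (U w)%:R] `&` [set w | y < (Z i w)%:R]) =
  nat_tail P U x * nat_tail P (Z i) y.
Proof.
move=> Di indU x y.
have [_ ] := event_independent_setI [set k | y < k%:R] (indU [set k | x < k%:R]) Di.
move=> /(congr1 fine); rewrite fineM ?fin_num_measure //; last exact: mZ.
by case: (indU [set k | x < k%:R]).
Qed.

Lemma partial_sum_tail k : nat_tail P (S k) x / F x @[x --> +oo] --> (k%:R : R).
Proof.
elim: k => [|k IH].
  apply: cvg_pinfty_epsP => e e0; apply: (@near_pinfty_gtP _ _ 0) => x x0;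
    rewrite (_ : nat_tail _ _ _ = 0) ?mul0r ?sub0r ?oppr_le0 ?addr0 ?add0r ?ltW //.
  - rewrite /nat_tail (_ : [set _ | _] = set0) ?/pr ?measure0 // -subset0 => w /=.
    by rewrite /S /partial_sum big_nil ltNge x0.
  - rewrite /nat_tail (_ : [set _ | _] = set0) ?/pr ?measure0 // -subset0 => w /=.
    by rewrite /S /partial_sum big_nil ltNge x0.
rewrite -natr1 /S partial_sumS.
have [|Tu Tl] := @nat_tail_add _ _ _ P _ _ (mS k) (mZ (b k)).
  apply: (@nat_tail_product _ (D `\` [set b i | i in `I_k])).
    exact: (unused_next b_inj).
  move=> B; rewrite -[X in event_independent _ _ X]setTI.
  exact: partial_sum_independent.
apply: (@tail_add_cvg _ F alpha rvF (nat_tail P (S k)) (nat_tail P (Z (b k)))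
  _ _ _ Tu Tl IH).
under eq_fun do rewrite tailF.
apply: cvg_pinfty_epsP => e e0; apply: (@near_pinfty_gtP _ _ 0) => x _;
  by rewrite divff ?gt_eqF ?(rv_gt0 rvF) //; lra.
Qed.

Context (c EN : R) (c0 : 0 <= c) (meanN : nat_mean P N = EN%:E)
  (tailN : nat_tail P N x / F x @[x --> +oo] --> c)
  (tailj : nat_tail P (Z j) x / F x @[x --> +oo] --> (0 : R)).

Let mean_p M : \sum_(0 <= k < M) p k * k%:R <= m.
Proof.
have := nat_mean_ge_partial (mZ (b 0)) (meanZ 0) M.
by under eq_bigr do rewrite lawp.
Qed.

Lemma sum_with_immigration_tail :
  nat_tail P sum_with_immigration x / F x @[x --> +oo] --> EN + c * m `^ alpha.
Proof.
have [|Tu Tl] := @nat_tail_add _ _ _ P _ _ mSN (mZ j).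
  by apply: nat_tail_product random_sum_independent.
rewrite -[EN + _]addr0.
apply: (@tail_add_cvg _ F alpha rvF (nat_tail P random_sum) (nat_tail P (Z j))
  _ _ _ Tu Tl _ tailj).
apply: (random_sum_tail_cvg rvF (a := fun k => pr P (N @^-1` [set k]))
  (s := fun k => nat_tail P (S k)) (GN := nat_tail P N) m0 c0) => //.
- by move=> k; exact: pr_ge0.
- by move=> y; exact: nat_tail_ge0.
- by move=> y; exact: nat_tail_truncn.
- exact: partial_sum_tail.
- move=> d d01; have [|C C0 HC] := conv_tail_uniform pF rvF _ d01 (ltW m0).
    by move=> M; exact: mean_p.
  exists C => // k x x0 kx.
  by rewrite /S (nat_tail_partial_sum b_inj Db indT lawp _ (ltW x0)); exact: HC.
- move=> d d01; have [|K HK] := nat_mean_approx (mZ (b 0)) (meanZ 0) (e := d / 4 * m).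
    by rewrite mulr_gt0 // divr_gt0 //; case/andP: d01.
  have HK' : (1 - d / 4) * m <= \sum_(0 <= k < K.+1) p k * k%:R.
    under [leRHS]eq_bigr do rewrite -(lawp 0).
    apply: le_trans (_ : \sum_(0 <= k < K) pr P (Z (b 0) @^-1` [set k]) * k%:R <= _).
      by apply: le_trans HK; lra.
    by rewrite big_nat_recr //= lerDl mulr_ge0 // pr_ge0.
  have [kappa k0 Hk] := conv_tail_lower pF rvF d01 m0 HK'.
  exists K%:R, kappa => // n x Kx xn.
  rewrite /S (nat_tail_partial_sum b_inj Db indT lawp); first exact: Hk.
  by apply: le_trans Kx.
- by move=> K; exact: nat_mean_ge_partial.
- by move=> e e0; exact: nat_mean_approx.
- by move=> x K; exact: random_sum_tail_upper.
- by move=> x K n; exact: random_sum_tail_lower.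
Qed.

Lemma integral_independent E i : event_independent Z D E -> D i ->
  (\int[P]_(w in E) (Z i w)%:R%:E = P E * nat_mean P (Z i))%E.
Proof.
move=> iE Di; have mE : measurable E by case: iE.
rewrite integral_levels ?nat_mean_levels // (prE P mE) -nneseriesZl; last first.
  by move=> k _; rewrite mule_ge0 ?lee_fin.
apply: eq_eseriesr => k _; rewrite muleCA; congr (_ * _)%E.
by rewrite -(prE P mE); have [_ ->] := event_independent_setI [set k] iE Di.
Qed.

Lemma integral_partial_sum E k : event_independent Z D E ->
  (\int[P]_(w in E) (S k w)%:R%:E = P E * (k%:R * m)%:E)%E.
Proof.
move=> iE; have mE : measurable E by case: iE.
elim: k => [|k IH].
  rewrite mul0r mule0; apply: integral0_eq => w _.
  by rewrite /S /partial_sum big_nil.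
rewrite /S partial_sumS.
under eq_integral do rewrite natrD EFinD.
rewrite ge0_integralD //; first last.
- exact: measurable_fun_levels.
- exact: (measurable_fun_levels (mS k)).
rewrite -/S IH integral_independent // meanZ -muleDr ?fin_num_adde_defl //.
  by rewrite -EFinD -natr1 mulrDl mul1r.
by rewrite fin_num_measure.
Qed.

(** Wald's identity: on the event [N = k] the integral is that of a sum of [k] terms
    independent of this event. *)
Lemma sum_with_immigration_mean me : nat_mean P (Z j) = me%:E ->
  nat_mean P sum_with_immigration = (EN * m + me)%:E.
Proof.
move=> meanj.
have me0 : 0 <= me by rewrite -lee_fin -meanj nat_mean_ge0.
rewrite /nat_mean.
have -> : [set: T] = \bigcup_k (N @^-1` [set k]).
  by apply/seteqP; split=> // w _; exists (N w).
rewrite ge0_integral_bigcup //; first last.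
- by apply/trivIsetP => i k _ _ ik; rewrite -subset0 => w /= [h1 h2];
    move: ik; rewrite -h1 -h2 eqxx.
- by apply: measurable_fun_levels.
have term k : (\int[P]_(w in N @^-1` [set k]) (sum_with_immigration w)%:R%:E =
   m%:E * (k%:R%:E * P (N @^-1` [set k])) + me%:E * P (N @^-1` [set k]))%E.
  under eq_integral => w.
    rewrite inE => /= Nk; rewrite /sum_with_immigration /random_sum Nk natrD EFinD.
    over.
  rewrite ge0_integralD //; first last.
  - exact: measurable_fun_levels.
  - exact: (measurable_fun_levels (mS k)).
  rewrite integral_partial_sum // integral_independent // meanj.
  by rewrite (prE P (mN [set k])) -!EFinM; congr EFin; ring.
rewrite (eq_eseriesr (fun k _ => term k)) nneseriesD //; first last.
- by move=> k _; rewrite mule_ge0 ?lee_fin.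
- by move=> k _; rewrite !mule_ge0 ?lee_fin // ltW.
rewrite !nneseriesZl //; last by move=> k _; rewrite mule_ge0 ?lee_fin.
rewrite -nat_mean_levels // meanN.
have -> : (\sum_(0 <= k <oo) P (N @^-1` [set k]) = 1)%E.
  rewrite -(probability_setT P) (@P_levels _ _ _ P setT N) //.
  by apply: eq_eseriesr => k _; rewrite setTI.
by rewrite mule1 -EFinM -EFinD mulrC.
Qed.

End tails.
End random_sums.

(** * Moments and tails of integer-valued variables *)

Section integer_variables.
Context (disp : measure_display) (T : measurableType disp) (R : realType)
  (P : probability T R).
Implicit Types X Y : {RV P >-> nat}.

Lemma tailE X x : tail (realRV X) x = nat_tail P X x.
Proof.
rewrite /tail /ccdf /nat_tail /pr; congr (fine (P _)).
by apply/seteqP; split=> w /=; rewrite /natR in_itv /= andbT.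
Qed.

Lemma meanE X : mean X = nat_mean P X.
Proof. by rewrite /mean expectation_def. Qed.

Lemma identically_distributed_pr X Y B : identically_distributed X Y ->
  pr P (X @^-1` B) = pr P (Y @^-1` B).
Proof. by move=> XY; have := XY B; rewrite /pr /distribution /pushforward => ->. Qed.

Lemma identically_distributed_mean X Y : identically_distributed X Y ->
  nat_mean P X = nat_mean P Y.
Proof.
move=> XY; rewrite !nat_mean_levels; try exact: measurable_levels_RV.
apply: eq_eseriesr => k _; rewrite !prE; try exact: measurable_levels_RV.
by rewrite (identically_distributed_pr _ XY).
Qed.

Lemma nat_tail_cvg0 X : nat_tail P X x @[x --> +oo] --> 0.
Proof.
have := cvg_ccdfy0 (realRV X) => /fine_cvg.
by apply: cvg_trans; apply: near_eq_cvg; near=> x; rewrite /= -/(tail _ _) tailE.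
Unshelve. all: by end_near. Qed.

Lemma regularly_varying_rv_tail X alpha : regularly_varying (realRV X) alpha ->
  rv_tail (nat_tail P X) alpha.
Proof.
move=> [_ _ Xgt0 Xrat]; have mX := measurable_levels_RV X; split.
- move=> t; case: (ltP 0 t) => t0; first by rewrite -tailE; exact: Xgt0.
  apply: (lt_le_trans (Xgt0 _ ltr01)); rewrite tailE nat_tail_le //.
  exact: le_trans t0 _.
- by move=> t; apply: pr_le1; exact: (mX [set k | t < k%:R]).
- by move=> s t st; exact: nat_tail_le.
- exact: nat_tail_cvg0.
- move=> q q0; have := Xrat q q0.
  by apply: cvg_trans; apply: near_eq_cvg; near=> x; rewrite !tailE.
Unshelve. all: by end_near. Qed.

Lemma discrete_tail_law X :
  discrete_tail (fun k => pr P (X @^-1` [set k])) (nat_tail P X).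
Proof.
have mX := measurable_levels_RV X; split.
- by move=> k; exact: pr_ge0.
- move=> M; rewrite (eq_bigr (fun k => pr P (setT `&` X @^-1` [set k]))); last first.
    by move=> k _; rewrite setTI.
  rewrite -pr_levels // setTI /nat_tail -pr_setC; last first.
    exact: (mX [set k | M%:R < k%:R :> R]).
  congr pr; apply/seteqP; split=> w /=; rewrite ltr_nat ltnS.
    by move=> h; apply/negP; rewrite -leqNgt.
  by move/negP; rewrite -leqNgt.
- by move=> y y0; exact: nat_tail_truncn.
Qed.

Lemma nat_mean_gt0 X : (P [set w | X w = 0%N] < 1)%E -> (0 < nat_mean P X)%E.
Proof.
move=> X0; have mX := measurable_levels_RV X.
apply: lt_le_trans (_ : P (X @^-1` [set k | (0 < k)%N]) <= _)%E.
  have -> : X @^-1` [set k | (0 < k)%N] = ~` (X @^-1` [set 0%N]).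
    by apply/seteqP; split=> w /=; lia.
  rewrite probability_setC // sube_gt0; exact: X0.
rewrite -[X in (X <= _)%E]mul1e -integral_cst // /nat_mean integral_mkcond.
apply: ge0_le_integral => //.
- by move=> w _; rewrite /patch; case: ifP.
- apply/(measurable_restrict _ _ _).1 => //; exact: measurable_cst.
- exact: measurable_fun_levels.
move=> w _; rewrite /patch; case: ifP; rewrite lee_fin ?ler0n //.
by rewrite inE /= ler1n.
Qed.

Lemma moment_nat_mean X (r : R) : 1 <= r -> (moment r X < +oo)%E ->
  (nat_mean P X < +oo)%E.
Proof.
move=> r1; apply: le_lt_trans; rewrite /moment unlock.
apply: ge0_le_integral => //.
- by apply: measurable_fun_levels; exact: measurable_levels_RV.
- apply/measurable_EFinP; apply: (@measurableT_comp _ _ _ _ _ _ (fun x : R => x `^ r)).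
    exact: measurable_powR.
  exact: measurable_funP.
move=> w _; rewrite lee_fin /=; case: (X w) => [|k]; first by rewrite powR_ge0.
by rewrite /natR -[leLHS]powRr1 ?ler0n // ler_powR // ler1n.
Qed.

Lemma moment_tail X (r x : R) : 0 <= r -> 0 < x -> (moment r X < +oo)%E ->
  nat_tail P X x <= fine (moment r X) * x `^ (- r).
Proof.
move=> r0 x0 Xr; have mX := measurable_levels_RV X.
have m0 : (0 <= moment r X)%E.
  by apply: expectation_ge0 => w; exact: powR_ge0.
have mfin : moment r X \is a fin_num by rewrite ge0_fin_numE.
have mono : {in Num.nneg &, {homo (@powR R)^~ r : y z / y <= z}}.
  by move=> y z y0 z0 yz; rewrite ge0_ler_powR.
have H := @markov _ _ _ P (realRV X) (fun y => y `^ r) x x0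
  (measurable_powR r) (fun y _ => powR_ge0 y r) mono.
rewrite powRN ler_pdivlMr ?powR_gt0 // -lee_fin fineK // mulrC EFinM.
rewrite /nat_tail -prE; last exact: (mX [set k | x < k%:R]).
move: H; rewrite (_ : _ \o _ = fun w => realRV X w `^ r); last first.
  by apply/funext => w /=; rewrite ger0_norm // /natR ler0n.
apply: le_trans; apply: lee_wpmul2l; first by rewrite lee_fin powR_ge0.
apply: le_measure; rewrite ?inE.
- exact: (mX [set k | x < k%:R]).
- exact: (mX [set k | (x%:E <= `|(natR R k)%:E|)%E]).
by move=> w /= xw; rewrite lee_fin ger0_norm /natR ?ler0n // ltW.
Qed.

(** By Markov's inequality the tail is at most a multiple of [x `^ (- r)]. *)
Lemma moment_tail_negligible X (F : R -> R) (alpha r : R) : rv_tail F alpha ->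
  0 <= r -> alpha < r -> (moment r X < +oo)%E ->
  nat_tail P X x / F x @[x --> +oo] --> (0 : R).
Proof.
move=> rvF r0 ar Xr; apply: cvg_pinfty_epsP => e e0; last first.
  apply: (@near_pinfty_gtP _ _ 0) => x _; rewrite sub0r.
  apply: (@le_trans _ _ 0); first by rewrite oppr_le0 ltW.
  by rewrite divr_ge0 ?nat_tail_ge0 // ltW // (rv_gt0 rvF).
have := [elaborate cvgM (cvg_cst (fine (moment r X))) (rv_power_negligible rvF r0 ar)].
rewrite mulr0 => /cvg_pinfty_le /(_ e0) lim.
near=> x.
have x0 : 0 < x by near: x; exact: nbhs_pinfty_gt.
apply: le_trans (_ : fine (moment r X) * (x `^ (- r) / F x) <= _).
  by rewrite mulrA ler_pM2r ?invr_gt0 ?(rv_gt0 rvF) //; exact: moment_tail.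
by near: x; exact: lim.
Unshelve. all: by end_near. Qed.

End integer_variables.

(** * Galton-Watson processes with immigration *)

Section closed_form.
Context (R : realType) (m alpha e0 me : R).

(** Mean and tail constant of the [n]-th generation, by the recursions that a
    random sum with immigration imposes. *)
Fixpoint gen_mean n : R := if n is n'.+1 then gen_mean n' * m + me else e0.

Fixpoint gen_const n : R :=
  if n is n'.+1 then gen_mean n' + gen_const n' * m `^ alpha else 0.

Lemma gen_meanE n : gen_mean n = e0 * m ^+ n + me * \sum_(0 <= i < n) m ^+ i.
Proof.
elim: n => [|n IH] /=; first by rewrite big_nil expr0 mulr0 mulr1 addr0.
rewrite IH big_nat_recl // expr0 exprSr.
under [in RHS]eq_bigr do rewrite exprSr.
rewrite -mulr_suml; ring.
Qed.

(* the constant contributed by one ancestor living [n] generations earlier *)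
Let jumps n := m ^+ (n - 1) * \sum_(0 <= i < n) m `^ (i%:R * (alpha - 1)).

Lemma jumpsS n : 0 < m -> jumps n.+1 = m ^+ n + m `^ alpha * jumps n.
Proof.
move=> m0; set mu := m `^ (alpha - 1).
have muE i : m `^ (i%:R * (alpha - 1)) = mu ^+ i.
  by rewrite mulrC powRrM powR_mulrn // powR_ge0.
have malpha : m `^ alpha = m * mu.
  rewrite -[X in X * _]powRr1 ?ltW // -powRD ?[1 + _]addrC ?subrK //.
  by apply/implyP => _; rewrite gt_eqF.
rewrite /jumps malpha; under eq_bigr do rewrite muE.
under [in RHS]eq_bigr do rewrite muE.
rewrite subn1 /= big_nat_recl // expr0.
under eq_bigr do rewrite exprS.
rewrite -mulr_sumr; case: n => [|n]; first by rewrite big_nil; ring.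
by rewrite subn1 /= exprS; ring.
Qed.

Lemma gen_constE n : 0 < m -> gen_const n =
  e0 * jumps n + me * \sum_(1 <= i < n) jumps (n - i).
Proof.
move=> m0; pose J k := \sum_(0 <= i < k) jumps i.
have jumps0 : jumps 0 = 0 by rewrite /jumps big_nil mulr0.
have -> : \sum_(1 <= i < n) jumps (n - i) = J n.
  rewrite /J; case: n => [|n]; first by rewrite !big_nil.
  rewrite [RHS]big_nat_recl // jumps0 add0r big_add1 /=.
  by rewrite [RHS]big_nat_rev /= add0n; apply: eq_big_nat => i /andP[_ ni]; congr jumps; lia.
have JS k : J k.+1 = \sum_(0 <= i < k) m ^+ i + m `^ alpha * J k.
  rewrite /J big_nat_recl // jumps0 add0r mulr_sumr -big_split /=.
  by apply: eq_bigr => i _; exact: jumpsS.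
elim: n => [|n IH] /=; first by rewrite jumps0 /J big_nil !mulr0 addr0.
by rewrite IH gen_meanE jumpsS // JS; ring.
Qed.

End closed_form.

Section generations.
Context (disp : measure_display) (T : measurableType disp) (R : realType)
  (P : probability T R).
Context (X : nat -> {RV P >-> nat}) (xi : nat -> nat -> {RV P >-> nat})
  (eps : nat -> {RV P >-> nat}).
Context (hX : GaltonWatsonImmigration X xi eps).

Let Z := primitives (X 0%N) xi eps.

Definition later_indices n : set (unit + nat * nat + nat) :=
  [set a | match a with
           | inl (inl _) => False
           | inl (inr (k, i)) => (n < k)%N /\ (1 <= i)%N
           | inr k => (n < k)%N
           end].

Let offspring n i : unit + nat * nat + nat := inl (inr (n.+1, i.+1)).
Let immigration n : unit + nat * nat + nat := inr n.+1.

Let offspring_inj n : injective (offspring n).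
Proof. by move=> i k []. Qed.

Let offspring_later n i : later_indices n (offspring n i).
Proof. by split. Qed.

Let immigration_later n : later_indices n (immigration n).
Proof. exact: ltnSn. Qed.

Let immigration_new n : ~ range (offspring n) (immigration n).
Proof. by case. Qed.

Lemma independent_setT n : event_independent Z (later_indices n) setT.
Proof.
apply: event_independentW (mutually_independent_setT (GWI_independent hX)).
move=> [[[]|[k i]]|k] //= [].
- by move=> nk i1; split=> //; exact: leq_trans nk.
- by move=> nk; exact: leq_trans nk.
Qed.

Lemma generationS n : X n.+1 = sum_with_immigration Z (offspring n) (immigration n) (X n)
  :> (T -> nat).
Proof.
apply/funext => w; rewrite (GWI_recursion hX) // big_add1 /=.
by rewrite /sum_with_immigration /partial_sum /=.
Qed.

Lemma generation_independent n B : event_independent Z (later_indices n) (X n @^-1` B).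
Proof.
elim: n B => [|n IH] B.
  have iT := mutually_independent_setT (GWI_independent hX).
  have [iX _] := @event_independent_setI _ _ _ _ _ _ _ _ (inl (inl tt)) B iT I.
  rewrite setTI in iX; apply: event_independentW iX => -[[[]|[k i]]|k] //=.
rewrite generationS.
apply: event_independentW (sum_with_immigration_independent (@offspring_inj n)
  (@offspring_later n) (@immigration_later n) (@immigration_new n) IH B).
move=> [[[]|[k i]]|k] //= nk; split; first split.
- by case: nk => nk i1; split=> //; exact: ltnW.
- by case: nk => nk _ [l _ [kn _]]; rewrite kn ltnn in nk.
- by [].
- by split; [exact: ltnW | case].
- by move=> [kn]; rewrite kn ltnn in nk.
Qed.

Context (alpha m e0 me : R).
Let F := nat_tail P (xi 1%N 1%N).
Context (rvF : rv_tail F alpha) (m0 : 0 < m) (e00 : 0 <= e0) (me0 : 0 <= me).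
Context (mean_xi : nat_mean P (xi 1%N 1%N) = m%:E)
  (mean_X0 : nat_mean P (X 0%N) = e0%:E) (mean_eps : nat_mean P (eps 1%N) = me%:E).
Context (tail_X0 : nat_tail P (X 0%N) x / F x @[x --> +oo] --> (0 : R))
  (tail_eps : nat_tail P (eps 1%N) x / F x @[x --> +oo] --> (0 : R)).

Lemma gen_mean_ge0 n : 0 <= gen_mean m e0 me n.
Proof. by elim: n => //= n IH; rewrite addr_ge0 // mulr_ge0 // ltW. Qed.

Lemma gen_const_ge0 n : 0 <= gen_const m alpha e0 me n.
Proof.
elim: n => //= n IH; rewrite addr_ge0 ?gen_mean_ge0 // mulr_ge0 // powR_ge0 //.
Qed.

(** At generation 0 the constant is 0, as the tail of [X 0] is negligible. *)
Lemma generation_asymptotics n :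
  nat_mean P (X n) = (gen_mean m e0 me n)%:E /\
  nat_tail P (X n) x / F x @[x --> +oo] --> gen_const m alpha e0 me n.
Proof.
elim: n => [|n [IHm IHt]]; first by split.
have id_xi i : identically_distributed (Z (offspring n i)) (xi 1%N 1%N).
  exact: (GWI_offspring_id hX).
have id_eps : identically_distributed (Z (immigration n)) (eps 1%N).
  exact: (GWI_immigration_id hX).
have law i k : pr P (Z (offspring n i) @^-1` [set k]) = pr P (xi 1%N 1%N @^-1` [set k]).
  exact: identically_distributed_pr.
have tailZ i x : nat_tail P (Z (offspring n i)) x = F x.
  exact: (identically_distributed_pr [set k | x < k%:R] (id_xi i)).
have meanZ i : nat_mean P (Z (offspring n i)) = m%:E.
  by rewrite (identically_distributed_mean (id_xi i)).
have meanj : nat_mean P (Z (immigration n)) = me%:E.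
  by rewrite (identically_distributed_mean id_eps).
have tailj : nat_tail P (Z (immigration n)) x / F x @[x --> +oo] --> (0 : R).
  rewrite (_ : nat_tail P (Z (immigration n)) = nat_tail P (eps 1%N)) //.
  by apply/funext => x; exact: (identically_distributed_pr [set k | x < k%:R] id_eps).
rewrite generationS; split.
  exact: (sum_with_immigration_mean (@offspring_inj n) (@offspring_later n)
    (@immigration_later n) (@immigration_new n) (@independent_setT n)
    (@generation_independent n) m0 meanZ IHm meanj).
exact: (sum_with_immigration_tail (@offspring_inj n) (@offspring_later n)
  (@immigration_later n) (@immigration_new n) (@independent_setT n)
  (@generation_independent n) rvF (discrete_tail_law (xi 1%N 1%N)) m0 law tailZ meanZ
  (gen_const_ge0 n) IHm IHt tailj).
Qed.

Lemma gen_mean_gt0 n : 0 < e0 \/ 0 < me -> (n = 0%N -> 0 < e0) ->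
  0 < gen_mean m e0 me n.
Proof.
move=> h; case: n => [|n] hn /=; first exact: hn.
elim: n {hn} => [|n IH] /=; last by rewrite ltr_wpDr // mulr_gt0.
case: h => h; first by rewrite ltr_wpDr // mulr_gt0.
by rewrite ltr_wpDl // mulr_ge0 // ltW.
Qed.

Lemma gen_const_gt0 n : 0 < e0 \/ 0 < me -> (n = 0%N -> 0 < e0) ->
  0 < gen_const m alpha e0 me n.+1.
Proof.
move=> h hn /=; rewrite ltr_wpDr ?gen_mean_gt0 //.
by rewrite mulr_ge0 ?gen_const_ge0 // powR_ge0.
Qed.

End generations.

(** The tail ratio of [Y] differs from that of [F] by a quotient of two functions with
    the same nonzero limit [c]. *)
Lemma tail_equiv_regularly_varying (disp : measure_display) (T : measurableType disp)
    (R : realType) (P : probability T R) (Y : {RV P >-> nat}) (F : R -> R) (alpha c : R) :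
  0 <= alpha -> 0 < c -> rv_tail F alpha ->
  nat_tail P Y x / F x @[x --> +oo] --> c -> regularly_varying (realRV Y) alpha.
Proof.
move=> a0 c0 rvF Yc; have mY := measurable_levels_RV Y.
have Ygt0 x : 0 < nat_tail P Y x.
  have /cvgr_gt /(_ 0 c0) /near_pinftyP [M M0 HM] := Yc.
  apply: lt_le_trans (_ : nat_tail P Y (Num.max x M) <= _); last first.
    by apply: nat_tail_le => //; rewrite le_max lexx.
  have := HM (Num.max x M); rewrite le_max lexx orbT => /(_ isT).
  by rewrite pmulr_lgt0 // invr_gt0 (rv_gt0 rvF).
split=> // [x _|q q0].
  by rewrite tailE.
have := [elaborate cvgM (cvgM (cvg_pinfty_scale q0 Yc) (rv_ratio rvF q0))
  (cvgV (lt0r_neq0 c0) Yc)].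
rewrite mulrAC divff ?gt_eqF // mul1r.
apply: cvg_trans; apply: near_eq_cvg; near=> x; rewrite /= !tailE.
have h1 := lt0r_neq0 (rv_gt0 rvF x); have h2 := lt0r_neq0 (rv_gt0 rvF (q * x)).
have h3 := lt0r_neq0 (Ygt0 x); by field; rewrite h1 h2 h3.
Unshelve. all: by end_near. Qed.

(* The degenerate case [n = 1], [X 0 = 0] almost surely is excluded: there
   [X 1] is distributed as [eps 1], the right-hand side vanishes, and neither
   conclusion holds (take [eps 1 = 1]).
   The means of [X 0], [xi] and [eps] are finite under the hypotheses, so that
   [fine] merely reads them as real numbers. *)
Theorem proposition2p1 (d : measure_display) (T : measurableType d)
    (R : realType) (P : probability T R)
    (X : nat -> {RV P >-> nat}) (xi : nat -> nat -> {RV P >-> nat})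
    (eps : nat -> {RV P >-> nat}) (alpha : R)
    (hX : GaltonWatsonImmigration X xi eps)
    (halpha : 1 <= alpha)
    (hxi : regularly_varying (realRV (xi 1%N 1%N)) alpha)
    (hmom : exists2 r : R, alpha < r &
      (moment r (X 0%N) < +oo)%E /\ (moment r (eps 1%N) < +oo)%E)
    (hnz : (P [set w | X 0%N w = 0%N] < 1)%E \/
           (P [set w | eps 1%N w = 0%N] < 1)%E)
    (hmean : alpha = 1 -> (0 < mean (xi 1%N 1%N) < +oo)%E) :
  forall n : nat, (1 <= n)%N ->
  (n = 1%N -> (P [set w | X 0%N w = 0%N] < 1)%E) ->
  let m_xi : R := fine (mean (xi 1%N 1%N)) in
  let m_eps : R := fine (mean (eps 1%N)) in
  asymp_equiv
    (tail (realRV (X n)))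
    (fun x =>
      fine (mean (X 0%N)) * m_xi ^+ (n - 1)
        * (\sum_(0 <= i < n) m_xi `^ (i%:R * (alpha - 1)))
        * tail (realRV (xi 1%N 1%N)) x
      + m_eps
        * (\sum_(1 <= i < n) m_xi ^+ (n - i - 1)
            * \sum_(0 <= j < n - i) m_xi `^ (j%:R * (alpha - 1)))
        * tail (realRV (xi 1%N 1%N)) x)
  /\ regularly_varying (realRV (X n)) alpha.
Proof.
have [r ar [mX0 meps]] := hmom.
have r1 : 1 <= r by apply: le_trans halpha (ltW ar).
have r0 : 0 <= r by apply: le_trans r1.
have rvF := regularly_varying_rv_tail hxi.
set F := nat_tail P (xi 1%N 1%N) in rvF.
have finE (Y : {RV P >-> nat}) : (nat_mean P Y < +oo)%E ->
    nat_mean P Y = (fine (nat_mean P Y))%:E.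
  by move=> Yfin; rewrite fineK // ge0_fin_numE // nat_mean_ge0.
have xi_fin : (nat_mean P (xi 1%N 1%N) < +oo)%E.
  move: halpha; rewrite le_eqVlt => /orP[/eqP a1|a1].
    by have := hmean (esym a1); rewrite meanE => /andP[].
  have [B HB] := rv_sum_bounded rvF a1.
  by apply: (nat_mean_fin (measurable_levels_RV (xi 1%N 1%N)) HB).
have X0E := finE _ (moment_nat_mean r1 mX0).
have epsE := finE _ (moment_nat_mean r1 meps).
have xiE := finE _ xi_fin.
have m0 : 0 < fine (nat_mean P (xi 1%N 1%N)).
  rewrite -lte_fin -xiE; apply: nat_mean_gt0.
  have mxi := measurable_levels_RV (xi 1%N 1%N).
  rewrite -[X in (X < _)%E]/(P (xi 1%N 1%N @^-1` [set 0%N])) prE // lte_fin.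
  have := discrete_tail_law (xi 1%N 1%N) => /dt_sum /(_ 0%N); rewrite big_nat1 => ->.
  by have := rv_gt0 rvF 0; rewrite -/F; lra.
have pos (Y : {RV P >-> nat}) : nat_mean P Y = (fine (nat_mean P Y))%:E ->
    (P [set w | Y w = 0%N] < 1)%E -> 0 < fine (nat_mean P Y).
  by move=> YE /nat_mean_gt0; rewrite YE lte_fin.
move=> [//|n] _ hn1 m_xi m_eps.
have [_ tailX] := generation_asymptotics hX rvF m0 (fine_ge0 (nat_mean_ge0 _ _))
  (fine_ge0 (nat_mean_ge0 _ _)) xiE X0E epsE
  (moment_tail_negligible rvF r0 ar mX0) (moment_tail_negligible rvF r0 ar meps) n.+1.
set c := gen_const _ _ _ _ _ in tailX.
have c0 : 0 < c.
  apply: gen_const_gt0 => //; try exact: fine_ge0 (nat_mean_ge0 _ _).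
    by case: hnz => h; [left|right]; exact: pos.
  by move=> n0; apply: pos => //; apply: hn1; rewrite n0.
split; last exact: tail_equiv_regularly_varying (le_trans ler01 halpha) c0 rvF tailX.
rewrite /asymp_equiv.
have := [elaborate cvgM tailX (cvg_cst c^-1)]; rewrite divff ?gt_eqF //.
apply: cvg_trans; apply: near_eq_cvg; near=> x; rewrite /= !tailE -/F.
rewrite -mulrDl [X in _ = _ / (X * _)](_ : _ = c).
  by rewrite [(c * _)^-1]invfM [c^-1 * _]mulrC mulrA.
by rewrite /c gen_constE // /m_xi /m_eps !meanE !mulrA.
Unshelve. all: by end_near. Qed.
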